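(* Let $N\ge 3$ and let $K=K_1\cup K_2\subset\mathbb{R}^N$ be a compact set with finitely many connected components as described in the context, with $K_1\neq\emptyset$. Let $f\in C^1(0,\infty)$ be a positive and decreasing function, and let $\varphi\in C^{0,\gamma}(0,\infty)$ ($0<\gamma<1$) be a positive and nonincreasing function. Then the inequality $$-\Delta u\ge \varphi(\delta_K(x))f(u)\quad\text{in }\mathbb{R}^N\setminus K$$ has $C^2$ positive solutions $u$ if and only if $$\int_0^\infty r\varphi(r)\,dr<\infty.$$
   Context: $K\subset\mathbb{R}^N$ ($N\ge3$) is a nonempty compact set with finitely many connected components, each of which is either the closure of a $C^2$ domain or a single point. $K_1$ denotes the union of all components of $K$ which are closures of $C^2$ domains, and $K_2$ denotes the set of all isolated points of $K$ (the singleton components), so $K=K_1\cup K_2$. $\delta_K(x)=\mathrm{dist}(x,\partial K)$. $C^{0,\gamma}(0,\infty)$ means Hölder continuous with exponent $\gamma$ on compact subintervals of $(0,\infty)$. ''Decreasing'' means strictly decreasing. A $C^2$ positive solution is a function $u\in C^2(\mathbb{R}^N\setminus K)$, $u>0$, satisfying the inequality pointwise. *)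

(* Defs.v *)
From HB Require Import structures.
From mathcomp Require Import all_boot all_order all_algebra.
From mathcomp Require Import all_classical all_reals all_analysis.

Set Implicit Arguments.
Unset Strict Implicit.
Unset Printing Implicit Defensive.

Import Order.TTheory GRing.Theory Num.Theory.
Import numFieldNormedType.Exports.

Local Open Scope classical_set_scope.
Local Open Scope ring_scope.

(* The library norm `|x| on 'rV[R]_n is the sup norm. It induces the usual
   topology, but distances and balls here must be Euclidean. *)
Definition enorm (R : realType) (n : nat) (x : 'rV[R]_n) : R :=
  Num.sqrt (\sum_(i < n) x 0 i ^+ 2).

Definition edist_set (R : realType) (n : nat) (x : 'rV[R]_n)
    (A : set 'rV[R]_n) : R :=
  inf [set enorm (x - y) | y in A].

Definition boundary (T : topologicalType) (A : set T) : set T :=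
  closure A `\` interior A.

Definition pderiv (R : realType) (n : nat) (i : 'I_n) (u : 'rV[R]_n -> R) :
    'rV[R]_n -> R :=
  'D_(delta_mx 0 i) u.

Definition laplacian (R : realType) (n : nat) (u : 'rV[R]_n -> R)
    (x : 'rV[R]_n) : R :=
  \sum_(i < n) pderiv i (pderiv i u) x.

(* Intended for U open: then the values of u outside U are irrelevant. *)
Definition C2_on (R : realType) (n : nat) (U : set 'rV[R]_n)
    (u : 'rV[R]_n -> R) : Prop :=
  forall x : 'rV[R]_n, U x ->
    [/\ {for x, continuous u},
        forall i : 'I_n, derivable u x (delta_mx 0 i) /\
          {for x, continuous (pderiv i u)} &
        forall i j : 'I_n, derivable (pderiv i u) x (delta_mx 0 j) /\
          {for x, continuous (pderiv j (pderiv i u))}].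

(* Near each boundary point, up to relabelling and reorienting the axes, the
   set D is the strict epigraph of a C^2 function of n - 1 variables: [i] is
   the distinguished coordinate, [b] its orientation, and [col' i x] collects
   the other coordinates. *)
Definition C2_boundary (R : realType) (n : nat) (D : set 'rV[R]_n) : Prop :=
  forall p, boundary D p ->
    exists (r : R) (i : 'I_n) (b : bool) (g : 'rV[R]_n.-1 -> R),
      [/\ 0 < r, C2_on setT g &
          forall x : 'rV[R]_n, enorm (x - p) < r ->
            (D x <-> g (col' i x) < (-1) ^+ b * x 0 i)].

Definition C2_domain (R : realType) (n : nat) (D : set 'rV[R]_n) : Prop :=
  [/\ D !=set0, open D, connected D & C2_boundary D].

Definition C2_domain_closure (R : realType) (n : nat) (C : set 'rV[R]_n) :
    Prop :=
  exists2 D, C2_domain D & C = closure D.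

Definition components (T : topologicalType) (K : set T) : set (set T) :=
  [set connected_component K x | x in K].

Definition finite_C2_or_point_components (R : realType) (n : nat)
    (K : set 'rV[R]_n) : Prop :=
  finite_set (components K) /\
  forall C, components K C ->
    C2_domain_closure C \/ exists a, C = [set a].

Definition K1_part (R : realType) (n : nat) (K : set 'rV[R]_n) :
    set 'rV[R]_n :=
  \bigcup_(C in [set C | components K C /\ C2_domain_closure C]) C.

Definition C1_pos (R : realType) (f : R -> R) : Prop :=
  forall t : R, 0 < t -> derivable f t 1 /\ {for t, continuous (derive1 f)}.

Definition locally_holder_pos (R : realType) (gam : R) (phi : R -> R) : Prop :=
  forall a b : R, 0 < a -> a <= b ->
    exists C : R, forall s t : R, a <= s <= b -> a <= t <= b ->
      `|phi s - phi t| <= C * `|s - t| `^ gam.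

(* Main.v *)
Require Import Defs.
From HB Require Import structures.
From mathcomp Require Import all_boot all_order all_algebra.
From mathcomp Require Import all_classical all_reals all_analysis.
From mathcomp Require Import measurable_realfun.
From mathcomp Require Import ring lra.

Set Implicit Arguments.
Unset Strict Implicit.
Unset Printing Implicit Defensive.

Import Order.TTheory GRing.Theory Num.Theory.
Import numFieldNormedType.Exports.

Local Open Scope classical_set_scope.
Local Open Scope ring_scope.

(** Let [moment] be a primitive of [r * phi r] on the half line. The integral in
    the statement is finite if and only if [moment] is bounded, so everything is
    expressed through [moment], and the barriers below are explicit in terms of
    primitives.

    Necessity. Where a solution [u] is below a level [M], monotonicity of [f] gives
    [- laplacian u > f M * phi (distance)]. Hence [u >= w] for every [w <= M] that
    satisfies the opposite inequality and lies below [u] on the boundary of a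
    region ([comparison_principle]). Take [w] as a multiple of a profile that solves
    [- laplacian W <= phi (distance)], scaled so that its supremum is [M], minus a
    superharmonic function that makes it nonpositive where nothing is known
    about [u]. If [moment] is unbounded, the supremum of the profile can be made
    arbitrarily large, so that the scaling factor satisfies the constraint imposed
    by [f M] for every [M]; but the profile stays close to its supremum at a fixed
    point, where [u >= M / 2] follows for every [M]. This is done
    twice: with a radial profile on a large annulus when [moment] is unbounded at
    infinity ([moment_bounded_above]; the subtracted function is a multiple of
    [1 / |x|], superharmonic because the dimension is at least three), and with a
    profile depending on a boundary layer when [moment] is unbounded at zero
    ([moment_bounded_below], which uses a boundary point of a component with
    nonempty interior).

    Boundary points. The distance to the boundary is not used as a coordinate. Near
    a boundary point of a component of class C^2 the boundary is a graph, and the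
    gap to the graph, corrected by a quadratic term, is a strictly superharmonic
    function of class C^2 comparable with the distance ([flattens_exists]).

    Existence. Since [f] is decreasing, [u = 1 + f 1 * V] is a solution as soon as
    [V >= 0] and [- laplacian V >= phi (distance)]. Such a [V] is a finite sum. Near
    an isolated point it is a radial potential. Near any other boundary point it is
    a concave function of the flattening function, made to exceed a constant away
    from that point and then capped by a concave function, so that it extends to the
    whole complement of [K] as a superharmonic function
    ([flattened_supersolution]). By compactness finitely many of these deal with a
    neighbourhood of the boundary, and a multiple of one more radial potential deals
    with the rest ([global_supersolution]). *)

(** * Calculus on the half line *)

Lemma ge0_is_derive_le (R : realType) (H h : R -> R) (a b : R) :
  a <= b ->
  (forall t : R, a <= t <= b -> is_derive t (1 : R) H (h t)) ->
  (forall t, a <= t <= b -> 0 <= h t) -> H a <= H b.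
Proof.
move=> ab dH h0.
have [||c + E] := @MVT_segment R H h a b ab.
- by move=> t /itvP tab; apply: dH; rewrite !tab.
- apply/continuous_in_subspaceT => t /set_mem /=; rewrite in_itv /= => tab.
  by apply/differentiable_continuous/derivable1_diffP; case: (dH t tab).
- by rewrite in_itv /= => /h0 hc; rewrite -subr_ge0 E mulr_ge0// subr_ge0.
Qed.

Lemma is_derive_increment_le (R : realType) (H h : R -> R) (a b k : R) :
  a <= b ->
  (forall t : R, a <= t <= b -> is_derive t (1 : R) H (h t)) ->
  (forall t, a <= t <= b -> h t <= k) -> H b - H a <= k * (b - a).
Proof.
move=> ab dH hk.
have : k * a - H a <= k * b - H b.
  apply: (@ge0_is_derive_le R (fun t => k * t - H t) (fun t => k - h t)) => //.
  - move=> t /dH dHt; apply: is_derive_eq.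
    by rewrite /GRing.scale /= mulr1.
  - by move=> t /hk; rewrite subr_ge0.
by rewrite mulrBr; lra.
Qed.

(** Integrals are oriented from left to right, so the primitive vanishing at [1] is
    defined by two cases; near each point it differs by a constant from the
    integral from a common left end point [a]. *)
Lemma antiderivative_pos (R : realType) (h : R -> R) :
  (forall t : R, 0 < t -> {for t, continuous h}) ->
  exists H : R -> R, forall t : R, 0 < t -> is_derive t (1 : R) H (h t).
Proof.
move=> ch.
pose F a t := \int[lebesgue_measure]_(x in `[a, t]) h x.
have ih (a b : R) : 0 < a -> lebesgue_measure.-integrable `[a, b] (EFin \o h).
  move=> a0; apply: continuous_compact_integrable; first exact: segment_compact.
  apply/continuous_in_subspaceT => t /set_mem /=; rewrite in_itv /= => /andP[at_ _].
  by apply: ch; exact: lt_le_trans at_.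

have FD (a b c : R) : 0 < a -> a <= b -> b <= c -> F a c = F a b + F b c.
  move=> a0 ab bc; apply/eqP; rewrite addrC -subr_eq; apply/eqP.
  rewrite /F Rintegral_itvB ?bnd_simp//; last exact: ih.
  rewrite Rintegral_itv_obnd_cbnd//; apply: integrableS (ih a c a0) => //.
  by apply: subset_itvr; rewrite bnd_simp.
have dF (a t : R) : 0 < a -> a < t -> is_derive t (1 : R) (F a) (h t).
  move=> a0 at_.
  have [||||+ E] := @continuous_FTC1_closed R h a t (t + 1).
  - by rewrite ltrDl.
  - exact: ih.
  - by [].
  - by apply: ch; exact: lt_trans at_.
  by move=> D; apply: DeriveDef => //; rewrite -derive1E.
exists (fun t => if 1 <= t then F 1 t else - F t 1) => t t0.
pose a := Num.min t 1 / 2.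
have m0 : 0 < Num.min t 1 by rewrite lt_min t0 ltr01.
have [a0 at_ a1] : [/\ 0 < a, a < t & a < 1].
  have : Num.min t 1 <= t /\ Num.min t 1 <= 1 by rewrite !ge_min !lexx orbT.
  by rewrite /a; split; lra.
have dFa : is_derive t (1 : R) (fun s => F a s - F a 1) (h t).
  have dFt := dF _ _ a0 at_; apply: is_derive_eq; first by rewrite subr0.
apply: near_eq_is_derive dFa; near=> s.
have as_ : a < s by near: s; exact: lt_nbhsr.
case: ifPn => [s1|]; first by rewrite (FD a 1 s)// ?ltW// addrC addKr.
by rewrite -ltNge => s1; rewrite (FD a s 1) ?ltW// opprD addNKr.
Unshelve. all: by end_near. Qed.

Lemma integral_segment_primitive (R : realType) (h H : R -> R) (a b : R) :
  (forall t : R, 0 < t -> {for t, continuous h}) ->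
  (forall t : R, 0 < t -> is_derive t (1 : R) H (h t)) ->
  0 < a -> a < b ->
  (\int[lebesgue_measure]_(x in `[a, b]) (h x)%:E = (H b - H a)%:E)%E.
Proof.
move=> ch dH a0 ab; have b0 := lt_trans a0 ab.
have cH (t : R) : 0 < t -> {for t, continuous H}.
  by move=> /dH[dHt _]; apply/differentiable_continuous/derivable1_diffP.
rewrite EFinB; apply: continuous_FTC2 => //.
- apply/continuous_in_subspaceT => t /set_mem /=; rewrite in_itv /= => /andP[at_ _].
  by apply: ch; exact: lt_le_trans at_.
- split.
  + move=> t; rewrite in_itv /= => /andP[at_ _].
    by case: (dH t); rewrite ?(lt_trans a0 at_).
  + exact/cvg_at_right_filter/cH.
  + exact/cvg_at_left_filter/cH.
- move=> t; rewrite in_itv /= => /andP[at_ _]; rewrite derive1E.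
  by have [_ ->] := dH t (lt_trans a0 at_).
Qed.

(** The integral over the half line is the total increment of a primitive, by
    exhaustion with the segments [[1/(n+2), n+2]]. *)
Lemma integral_pos_finiteP (R : realType) (h H : R -> R) :
  (forall t : R, 0 < t -> {for t, continuous h}) ->
  (forall t : R, 0 < t -> 0 <= h t) ->
  (forall t : R, 0 < t -> is_derive t (1 : R) H (h t)) ->
  (\int[lebesgue_measure]_(r in `]0%R, +oo[) (h r)%:E < +oo)%E <->
  exists M : R, forall a b : R, 0 < a -> a < b -> H b - H a <= M.
Proof.
move=> ch h0 dH.
have mh : measurable_fun (`]0, +oo[%classic : set R) (EFin \o h).
  apply/measurable_EFinP; apply: open_continuous_measurable_fun.
    exact: interval_open.
  by move=> t /set_mem /=; rewrite in_itv /= andbT => /ch.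
have h0' (t : R) : (`]0, +oo[%classic : set R) t -> (0 <= (h t)%:E)%E.
  by rewrite /= in_itv /= andbT lee_fin => /h0.
have sub (a b : R) : 0 < a -> `[a, b]%classic `<=` (`]0, +oo[%classic : set R).
  by move=> a0; apply: subset_itv; rewrite bnd_simp.
split.
- move=> fin; exists (fine (\int[lebesgue_measure]_(r in `]0%R, +oo[) (h r)%:E)%E).
  move=> a b a0 ab.
  rewrite -lee_fin -(integral_segment_primitive ch dH a0 ab) fineK.
    by apply: ge0_subset_integral => //; exact: sub.
  by rewrite ge0_fin_numE//; apply: integral_ge0.
- move=> [M HM].
  pose F (n : nat) : set (measurableTypeR R) := `[n.+2%:R^-1, n.+2%:R]%classic.
  have Fpos n : 0 < (n.+2%:R : R)^-1 by rewrite invr_gt0.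
  have FE : (`]0, +oo[%classic : set R) = \bigcup_n F n.
    apply/seteqP; split=> [t /=|t [n _ /=]]; last exact: sub.
    rewrite in_itv /= andbT => t0.
    pose m := Num.bound (t + t^-1).
    have ti : 0 < t^-1 by rewrite invr_gt0.
    have tm : t + t^-1 < m%:R by rewrite archi_boundP// addr_ge0 ?ltW.
    have mm : (m%:R <= m.+2%:R :> R) by rewrite ler_nat -addn2 leq_addr.
    exists m => //; rewrite /F /= in_itv /= -[X in _ <= X]invrK lef_pV2 ?posrE//.
    by apply/andP; split; lra.
  have := @ge0_nondecreasing_set_cvg_integral _ _ R F (EFin \o h) lebesgue_measure.
  rewrite -FE => cv; apply: (@le_lt_trans _ _ M%:E); last exact: ltry.
  apply: (cvge_to_le (cv _ _ _ _)).
  + move=> n m nm; apply/subsetPset/subset_itv; rewrite bnd_simp ?ler_nat//.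
    by rewrite lef_pV2 ?posrE// ler_nat.
  + by move=> n; exact: measurable_itv.
  + by move=> n; apply: measurable_funS mh => //; exact: sub.
  + by move=> n t Ft; apply: h0'; exact: sub (Fpos n) _ Ft.
  + near=> n; have n1 : (n.+2%:R : R)^-1 < n.+2%:R.
      by apply: (@lt_trans _ _ 1); rewrite ?invf_lt1 ?ltr1n.
    rewrite (integral_segment_primitive ch dH (Fpos n) n1) lee_fin.
    exact: HM.
Unshelve. all: by end_near. Qed.

Lemma is_derive_invr (R : realType) (t : R) : 0 < t ->
  is_derive t (1 : R) (fun s : R => s^-1) (- t ^- 2).
Proof.
move=> t0; have t_n0 : t != 0 by rewrite gt_eqF.
have D := @is_deriveV R id t _ 1 t_n0 (is_derive_id _ _).
by apply: (is_derive_eq D); rewrite /GRing.scale /= mulr1.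
Qed.

Lemma is_derive_invr_sqr (R : realType) (t : R) : 0 < t ->
  is_derive t (1 : R) (fun s : R => (s ^+ 2)^-1) (- (2 * t ^- 3)).
Proof.
move=> t0; have t_n0 : t != 0 by rewrite gt_eqF.
have t2_n0 : t ^+ 2 != 0 by rewrite expf_neq0.
have dsq : is_derive t (1 : R) (fun s : R => s ^+ 2) (2 * t).
  by apply: is_derive_eq; rewrite /GRing.scale /=; ring.
have D := @is_deriveV R (fun s => s ^+ 2) t _ 1 t2_n0 dsq.
by apply: (is_derive_eq D); rewrite /GRing.scale /=; field.
Qed.

(** * Second-order calculus in several variables *)

Lemma derive_line (R : realType) (V : normedModType R) (u : V -> R) (x w : V) :
  'D_(1 : R) (fun h : R => u (h *: w + x)) 0 = 'D_w u x.
Proof.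
rewrite /derive; set g1 := fun h => h^-1 *: _; set g2 := fun h => h^-1 *: _.
suff -> : g1 = g2 by [].
by rewrite funeqE /g1 /g2 => h /=; rewrite addr0 scale0r add0r [_%:A]mulr1.
Qed.

Lemma is_derive_line (R : realType) (V : normedModType R) (u : V -> R) (x w : V)
    (dux : R) :
  is_derive x w u dux <-> is_derive (0 : R) (1 : R) (fun h : R => u (h *: w + x)) dux.
Proof.
split=> -[D E]; split.
- exact: (iffLR (derivable1P u x w) D).
- by rewrite derive_line.
- exact: (iffRL (derivable1P u x w) D).
- by rewrite -derive_line.
Qed.

(** A directional derivative is the derivative of the restriction to a line, which
    reduces statements about it to one variable. *)
Lemma is_derive_line_at (R : realType) (V : normedModType R) (u : V -> R) (x w : V)
    (t dux : R) :
  is_derive (t *: w + x) w u dux <->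
  is_derive t (1 : R) (fun h : R => u (h *: w + x)) dux.
Proof.
rewrite is_derive_line [X in _ <-> X]is_derive_line.
suff -> : (fun h : R => u (h *: w + (t *: w + x))) =
          (fun h : R => u ((h *: (1 : R) + t) *: w + x)) by [].
by apply/funext => h; rewrite addrA -scalerDl [_ *: 1]mulr1.
Qed.

Definition gradsq (R : realType) (n : nat) (u : 'rV[R]_n -> R) (x : 'rV[R]_n) : R :=
  \sum_(i < n) pderiv i u x ^+ 2.

(** [C2_on] with explicit candidates for the partial derivatives, so that each
    closure property comes with the formulas for gradient and Laplacian. *)
Definition has_jet2 (R : realType) (n : nat) (U : set 'rV[R]_n) (u : 'rV[R]_n -> R)
    (du : 'I_n -> 'rV[R]_n -> R) (ddu : 'I_n -> 'I_n -> 'rV[R]_n -> R) : Prop :=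
  forall x : 'rV[R]_n, U x ->
  [/\ {for x, continuous u},
      forall i, is_derive x (delta_mx 0 i) u (du i x),
      forall i, {for x, continuous (du i)},
      forall i j, is_derive x (delta_mx 0 j) (du i) (ddu i j x) &
      forall i j, {for x, continuous (ddu i j)}].

Section Jet2.
Variables (R : realType) (n : nat) (U : set 'rV[R]_n).
Hypothesis oU : open U.
Implicit Types (u v : 'rV[R]_n -> R) (x : 'rV[R]_n).

Lemma for_continuous_near_eq (u v : 'rV[R]_n -> R) x :
  (\near x, u x = v x) -> {for x, continuous u} -> {for x, continuous v}.
Proof.
move=> uv; rewrite /prop_for /continuous_at -(nbhs_singleton uv).
move=> cu; apply: cvg_trans cu; exact: (@near_eq_cvg _ _ (nbhs x) _ _ _ uv).
Qed.

Lemma C2_onP u : C2_on U u <->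
  has_jet2 U u (fun i => pderiv i u) (fun i j => pderiv j (pderiv i u)).
Proof.
split=> H x /H.
  case=> cu d1 d2; split=> // [i|i|i j|i j].
  - by case: (d1 i) => /derivableP.
  - by case: (d1 i).
  - by case: (d2 i j) => /derivableP.
  - by case: (d2 i j).
by case=> cu d1 c1 d2 c2; split.
Qed.

Lemma has_jet2_pderiv u du ddu x i : has_jet2 U u du ddu -> U x ->
  pderiv i u x = du i x.
Proof. by move=> J /J[_ + _ _ _] => /(_ i)[_]. Qed.

Lemma has_jet2_near u du ddu x i : has_jet2 U u du ddu -> U x ->
  \near x, du i x = pderiv i u x.
Proof.
move=> J Ux; have := open_nbhs_nbhs (conj oU Ux).
by apply: filterS => y Uy; rewrite (has_jet2_pderiv _ J Uy).
Qed.

Lemma has_jet2_pderiv2 u du ddu x i j : has_jet2 U u du ddu -> U x ->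
  pderiv j (pderiv i u) x = ddu i j x.
Proof.
move=> J Ux; rewrite {1}/pderiv -(near_eq_derive _ (has_jet2_near i J Ux)).
by have [_ _ _ + _] := J x Ux => /(_ i j)[].
Qed.

Lemma has_jet2_C2 u du ddu : has_jet2 U u du ddu -> C2_on U u.
Proof.
move=> J x Ux; have [cu d1 c1 d2 c2] := J x Ux; split=> // [i|i j]; split.
- by case: (d1 i).
- exact: for_continuous_near_eq (has_jet2_near i J Ux) (c1 i).
- by apply: near_eq_derivable (has_jet2_near i J Ux) _; case: (d2 i j).
- apply: for_continuous_near_eq (c2 i j).
  have := open_nbhs_nbhs (conj oU Ux); apply: filterS => y Uy.
  by rewrite (has_jet2_pderiv2 _ _ J Uy).
Qed.

Lemma has_jet2_laplacian u du ddu x : has_jet2 U u du ddu -> U x ->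
  laplacian u x = \sum_(i < n) ddu i i x.
Proof.
by move=> J Ux; apply: eq_bigr => i _; rewrite (has_jet2_pderiv2 _ _ J Ux).
Qed.

Lemma has_jet2_gradsq u du ddu x : has_jet2 U u du ddu -> U x ->
  gradsq u x = \sum_(i < n) du i x ^+ 2.
Proof.
by move=> J Ux; apply: eq_bigr => i _; rewrite (has_jet2_pderiv _ J Ux).
Qed.

Lemma has_jet2_cst (c : R) : has_jet2 U (fun=> c) (fun _ _ => 0) (fun _ _ _ => 0).
Proof. by move=> x _; split=> *; try exact: cst_continuous; exact: is_derive_cst. Qed.

Lemma has_jet2D u du ddu v dv ddv : has_jet2 U u du ddu -> has_jet2 U v dv ddv ->
  has_jet2 U (fun x => u x + v x) (fun i x => du i x + dv i x)
    (fun i j x => ddu i j x + ddv i j x).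
Proof.
move=> Ju Jv x Ux; have [cu d1 c1 d2 c2] := Ju x Ux; have [cv e1 b1 e2 b2] := Jv x Ux.
split=> *; try (apply: continuousD => //; fail).
  exact: is_deriveD (d1 _) (e1 _).
exact: is_deriveD (d2 _ _) (e2 _ _).
Qed.

Lemma has_jet2Z (c : R) u du ddu : has_jet2 U u du ddu ->
  has_jet2 U (fun x => c * u x) (fun i x => c * du i x) (fun i j x => c * ddu i j x).
Proof.
move=> Ju x Ux; have [cu d1 c1 d2 c2] := Ju x Ux.
split=> *; try (apply: continuousM => //; exact: cst_continuous).
  exact: is_deriveZ (d1 _).
exact: is_deriveZ (d2 _ _).
Qed.

Lemma has_jet2_sum (T : Type) (s : seq T) (u : T -> 'rV[R]_n -> R) du ddu :
  (forall t, has_jet2 U (u t) (du t) (ddu t)) ->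
  has_jet2 U (fun x => \sum_(t <- s) u t x) (fun i x => \sum_(t <- s) du t i x)
    (fun i j x => \sum_(t <- s) ddu t i j x).
Proof.
move=> J; elim: s => [|t s IH].
  rewrite (_ : (fun x => \sum_(t <- [::]) u t x) = fun=> 0); last by apply/funext => x; rewrite big_nil.
  rewrite (_ : (fun i x => \sum_(t <- [::]) du t i x) = fun _ _ => 0); last first.
    by apply/funext => i; apply/funext => x; rewrite big_nil.
  rewrite (_ : (fun i j x => \sum_(t <- [::]) ddu t i j x) = fun _ _ _ => 0); first exact: has_jet2_cst.
  by apply/funext => i; apply/funext => j; apply/funext => x; rewrite big_nil.
have := has_jet2D (J t) IH.
rewrite (_ : (fun x => u t x + \sum_(t <- s) u t x) = fun x => \sum_(t <- t :: s) u t x); last first.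
  by apply/funext => x; rewrite big_cons.
rewrite (_ : (fun i x => du t i x + \sum_(t <- s) du t i x) = fun i x => \sum_(t <- t :: s) du t i x); last first.
  by apply/funext => i; apply/funext => x; rewrite big_cons.
rewrite (_ : (fun i j x => ddu t i j x + \sum_(t <- s) ddu t i j x) =
             fun i j x => \sum_(t <- t :: s) ddu t i j x) //.
by apply/funext => i; apply/funext => j; apply/funext => x; rewrite big_cons.
Qed.

Lemma is_derive_comp_scalar (F : R -> R) u x w (dF dux : R) :
  is_derive (u x) (1 : R) F dF -> is_derive x w u dux ->
  is_derive x w (fun y => F (u y)) (dF * dux).
Proof.
move=> HF /is_derive_line Hline; apply/is_derive_line.
have HF0 : is_derive ((fun h : R => u (h *: w + x)) 0) (1 : R) F dF.
  by rewrite /= scale0r add0r.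
exact: is_derive1_comp HF0 Hline.
Qed.

Lemma has_jet2_comp (I : set R) (F F' F'' : R -> R) u du ddu :
  has_jet2 U u du ddu -> (forall x, U x -> I (u x)) ->
  (forall t : R, I t -> is_derive t (1 : R) F (F' t)) ->
  (forall t : R, I t -> is_derive t (1 : R) F' (F'' t)) ->
  (forall t : R, I t -> {for t, continuous F''}) ->
  has_jet2 U (fun x => F (u x)) (fun i x => F' (u x) * du i x)
    (fun i j x => F'' (u x) * du i x * du j x + F' (u x) * ddu i j x).
Proof.
move=> Ju UI dF dF' cF x Ux; have [cu d1 c1 d2 c2] := Ju x Ux.
have Iu := UI x Ux.
have dcont G (g : R) : is_derive (u x) (1 : R) G g -> {for u x, continuous G}.
  by case=> dG _; exact/differentiable_continuous/derivable1_diffP.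
have cFu : {for x, continuous (fun y => F (u y))}.
  exact: (@continuous_comp _ _ _ u F x cu (dcont _ _ (dF _ Iu))).
have cF'u : {for x, continuous (fun y => F' (u y))}.
  exact: (@continuous_comp _ _ _ u F' x cu (dcont _ _ (dF' _ Iu))).
have cF''u : {for x, continuous (fun y => F'' (u y))}.
  exact: (@continuous_comp _ _ _ u F'' x cu (cF _ Iu)).
split=> // [i|i|i j|i j].
- exact: is_derive_comp_scalar (dF _ Iu) (d1 i).
- by apply: continuousM.
- have := is_deriveM (is_derive_comp_scalar (dF' _ Iu) (d1 j)) (d2 i j).
  move=> /is_derive_eq; apply; rewrite /GRing.scale /=; ring.
- apply: continuousD; apply: continuousM => //; exact: continuousM.
Qed.

End Jet2.
Lemma C2_on_sub (R : realType) (n : nat) (U V : set 'rV[R]_n) u :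
  V `<=` U -> C2_on U u -> C2_on V u.
Proof. by move=> VU C x /VU; exact: C. Qed.

Lemma pderiv_near_eq (R : realType) (n : nat) (u v : 'rV[R]_n -> R) (x : 'rV[R]_n) i :
  (\near x, u x = v x) -> \near x, pderiv i u x = pderiv i v x.
Proof.
move=> /near_join; apply: filterS => y uv; exact: near_eq_derive uv.
Qed.

Lemma laplacian_near_eq (R : realType) (n : nat) (u v : 'rV[R]_n -> R) (x : 'rV[R]_n) :
  (\near x, u x = v x) -> laplacian u x = laplacian v x.
Proof.
move=> uv; apply: eq_bigr => i _.
exact: nbhs_singleton (pderiv_near_eq i (pderiv_near_eq i uv)).
Qed.

Lemma C2_on_near_eq (R : realType) (n : nat) (u v : 'rV[R]_n -> R) (x : 'rV[R]_n) :
  (\near x, u x = v x) -> C2_on [set x] u -> C2_on [set x] v.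
Proof.
move=> uv /(_ _ erefl)[cu d1 d2] _ ->; split=> [|i|i j].
- exact: for_continuous_near_eq uv cu.
- have [D C] := d1 i; split; first exact: near_eq_derivable uv D.
  exact: for_continuous_near_eq (pderiv_near_eq i uv) C.
- have [D C] := d2 i j; have uvi := pderiv_near_eq i uv.
  split; first exact: near_eq_derivable uvi D.
  exact: for_continuous_near_eq (pderiv_near_eq j uvi) C.
Qed.

Section C2closure.
Variables (R : realType) (n : nat) (U : set 'rV[R]_n).
Hypothesis oU : open U.
Implicit Types (u v : 'rV[R]_n -> R) (x : 'rV[R]_n).

Lemma C2_on_cst (c : R) : C2_on U (fun=> c).
Proof. exact (has_jet2_C2 oU (@has_jet2_cst _ _ U c)). Qed.

Lemma laplacian_cst (c : R) x : laplacian (fun=> c) x = 0.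
Proof.
by rewrite (has_jet2_laplacian openT (@has_jet2_cst _ _ setT c))// big1.
Qed.

Lemma C2_onD u v : C2_on U u -> C2_on U v -> C2_on U (fun x => u x + v x).
Proof. by move=> /C2_onP Ju /C2_onP Jv; exact (has_jet2_C2 oU (has_jet2D Ju Jv)). Qed.

Lemma laplacianD u v x : C2_on U u -> C2_on U v -> U x ->
  laplacian (fun x => u x + v x) x = laplacian u x + laplacian v x.
Proof.
move=> /C2_onP Ju /C2_onP Jv Ux.
by rewrite (has_jet2_laplacian oU (has_jet2D Ju Jv))// big_split.
Qed.

Lemma C2_onZ (c : R) u : C2_on U u -> C2_on U (fun x => c * u x).
Proof. by move=> /C2_onP Ju; exact (has_jet2_C2 oU (has_jet2Z c Ju)). Qed.

Lemma laplacianZ (c : R) u x : C2_on U u -> U x ->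
  laplacian (fun x => c * u x) x = c * laplacian u x.
Proof.
move=> /C2_onP Ju Ux.
by rewrite (has_jet2_laplacian oU (has_jet2Z c Ju))// mulr_sumr.
Qed.

Lemma C2_on_sum (T : Type) (s : seq T) (u : T -> 'rV[R]_n -> R) :
  (forall t, C2_on U (u t)) -> C2_on U (fun x => \sum_(t <- s) u t x).
Proof.
move=> Cu; have J := has_jet2_sum s (fun t => iffLR (C2_onP U (u t)) (Cu t)).
exact (has_jet2_C2 oU J).
Qed.

Lemma laplacian_sum (T : Type) (s : seq T) (u : T -> 'rV[R]_n -> R) x :
  (forall t, C2_on U (u t)) -> U x ->
  laplacian (fun x => \sum_(t <- s) u t x) x = \sum_(t <- s) laplacian (u t) x.
Proof.
move=> Cu Ux; have J := has_jet2_sum s (fun t => iffLR (C2_onP U (u t)) (Cu t)).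
by rewrite (has_jet2_laplacian oU J)// exchange_big.
Qed.

Definition is_derive2_on (I : set R) (F F' F'' : R -> R) : Prop :=
  forall t : R, I t ->
  [/\ is_derive t (1 : R) F (F' t), is_derive t (1 : R) F' (F'' t) &
      {for t, continuous F''}].

Lemma has_jet2_comp_C2 (I : set R) (F F' F'' : R -> R) u :
  C2_on U u -> (forall x, U x -> I (u x)) -> is_derive2_on I F F' F'' ->
  has_jet2 U (fun x => F (u x)) (fun i x => F' (u x) * pderiv i u x)
    (fun i j x => F'' (u x) * pderiv i u x * pderiv j u x
                  + F' (u x) * pderiv j (pderiv i u) x).
Proof.
move=> /C2_onP Ju UI dF.
by apply: has_jet2_comp Ju UI _ _ _ => t /dF[].
Qed.

Lemma C2_on_comp (I : set R) (F F' F'' : R -> R) u :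
  C2_on U u -> (forall x, U x -> I (u x)) -> is_derive2_on I F F' F'' ->
  C2_on U (fun x => F (u x)).
Proof. by move=> Cu UI dF; exact (has_jet2_C2 oU (has_jet2_comp_C2 Cu UI dF)). Qed.

Lemma laplacian_comp (I : set R) (F F' F'' : R -> R) u x :
  C2_on U u -> (forall x, U x -> I (u x)) -> is_derive2_on I F F' F'' -> U x ->
  laplacian (fun x => F (u x)) x = F'' (u x) * gradsq u x + F' (u x) * laplacian u x.
Proof.
move=> Cu UI dF Ux.
rewrite (has_jet2_laplacian oU (has_jet2_comp_C2 Cu UI dF))// big_split /=.
congr (_ + _); rewrite mulr_sumr; apply: eq_bigr => i _ //.
by rewrite expr2 mulrA.
Qed.

Lemma gradsq_comp (I : set R) (F F' F'' : R -> R) u x :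
  C2_on U u -> (forall x, U x -> I (u x)) -> is_derive2_on I F F' F'' -> U x ->
  gradsq (fun x => F (u x)) x = F' (u x) ^+ 2 * gradsq u x.
Proof.
move=> Cu UI dF Ux.
rewrite (has_jet2_gradsq (has_jet2_comp_C2 Cu UI dF))// /gradsq mulr_sumr.
by apply: eq_bigr => i _; rewrite exprMn.
Qed.

Lemma for_continuous_sum (s : seq 'I_n) (u : 'I_n -> 'rV[R]_n -> R) x :
  (forall i, {for x, continuous (u i)}) ->
  {for x, continuous (fun y => \sum_(i <- s) u i y)}.
Proof.
move=> cu; elim: s => [|i s IH].
  rewrite (_ : (fun y => \sum_(i <- [::]) u i y) = fun=> 0); first exact: cst_continuous.
  by apply/funext => y; rewrite big_nil.
rewrite (_ : (fun y => \sum_(j <- i :: s) u j y) =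
             fun y => u i y + \sum_(j <- s) u j y); first by apply: continuousD.
by apply/funext => y; rewrite big_cons.
Qed.

Lemma C2_on_continuous_laplacian u x : C2_on U u -> U x ->
  {for x, continuous (laplacian u)}.
Proof.
move=> Cu Ux; apply: for_continuous_sum => i.
by have [_ _ /(_ i i)[]] := Cu x Ux.
Qed.

Lemma C2_on_continuous_gradsq u x : C2_on U u -> U x ->
  {for x, continuous (gradsq u)}.
Proof.
move=> Cu Ux; apply: for_continuous_sum => i.
have [_ /(_ i)[_ ci] _] := Cu x Ux.
exact: (@continuousM _ _ _ _ _ ci ci).
Qed.

End C2closure.

Lemma has_jet2_coord (R : realType) (n : nat) (U : set 'rV[R]_n) (i : 'I_n) (a : R) :
  has_jet2 U (fun x => x 0 i - a) (fun j _ => (i == j)%:R) (fun _ _ _ => 0).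
Proof.
move=> x _; split=> *; try exact: cst_continuous; try exact: is_derive_cst.
  by apply: continuousB; [exact: coord_continuous|exact: cst_continuous].
apply/is_derive_line; under eq_fun do rewrite !mxE eqxx /=.
apply: is_derive_eq; rewrite /GRing.scale /=; ring.
Qed.

Lemma is_derive2_on_sqr (R : realType) (I : set R) :
  is_derive2_on I (fun t => t ^+ 2) (fun t => 2 * t) (fun=> 2).
Proof.
move=> t _; split; last exact: cst_continuous.
  by apply: is_derive_eq; rewrite /GRing.scale /=; ring.
by apply: is_derive_eq; rewrite /GRing.scale /=; ring.
Qed.

Lemma is_derive2_on_sqrt (R : realType) :
  is_derive2_on [set t : R | 0 < t] Num.sqrt (fun t => (2 * Num.sqrt t)^-1)
    (fun t => - (4 * t * Num.sqrt t)^-1).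
Proof.
move=> t /= t0; have s0 : 0 < Num.sqrt t by rewrite sqrtr_gt0.
split; first exact: is_derive1_sqrt.
  have ds := is_derive1_sqrt t0.
  have s20 : 2 * Num.sqrt t != 0 by rewrite mulf_neq0// gt_eqF.
  have d2s : is_derive t (1 : R) (fun s : R => 2 * Num.sqrt s) (Num.sqrt t)^-1.
    by apply: is_derive_eq; rewrite /GRing.scale /= invfM mulrA divff ?mul1r.
  have D := @is_deriveV R (fun s => 2 * Num.sqrt s) t _ 1 s20 d2s.
  apply: (is_derive_eq D).
  rewrite /GRing.scale /= mulNr -invfM exprMn sqr_sqrtr ?ltW//.
  by congr (- (_ * _ * _)^-1); rewrite -natrX.
apply: cvgN; apply: cvgV; first by rewrite !mulf_neq0 ?gt_eqF.
by apply: cvgM; [apply: cvgM; [exact: cvg_cst|exact: cvg_id]|exact: sqrt_continuous].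
Qed.

Definition sqdist (R : realType) (n : nat) (a x : 'rV[R]_n) : R :=
  \sum_(i < n) (x 0 i - a 0 i) ^+ 2.

Lemma sum_mulr_delta (R : realType) (n : nat) (c : 'I_n -> R) (i : 'I_n) :
  \sum_(k < n) c k * (k == i)%:R = c i.
Proof.
rewrite (bigD1 i)//= eqxx mulr1 big1 ?addr0// => k /negPf ->; exact: mulr0.
Qed.

Lemma has_jet2_sqdist (R : realType) (n : nat) (U : set 'rV[R]_n) (a : 'rV[R]_n) :
  has_jet2 U (sqdist a)
    (fun i x => \sum_(k < n) 2 * (x 0 k - a 0 k) * (k == i)%:R)
    (fun i j x => \sum_(k < n) 2 * (k == i)%:R * (k == j)%:R).
Proof.
apply: has_jet2_sum => k x Ux.
have := @has_jet2_comp R n U setT (fun t => t ^+ 2) (fun t => 2 * t) (fun=> 2) _ _ _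
  (@has_jet2_coord R n U k (a 0 k)) (fun _ _ => I).
have sq := @is_derive2_on_sqr R setT.
move=> /(_ (fun t p => let: And3 q _ _ := sq t p in q)).
move=> /(_ (fun t p => let: And3 _ q _ := sq t p in q)).
move=> /(_ (fun t p => let: And3 _ _ q := sq t p in q) x Ux).
case=> ? ? ? d2 ?; split => // [i j|i j]; last exact: cst_continuous.
by apply: is_derive_eq (d2 i j) _; rewrite mulr0 addr0.
Qed.

Lemma C2_on_sqdist (R : realType) (n : nat) (U : set 'rV[R]_n) (a : 'rV[R]_n) :
  C2_on U (sqdist a).
Proof.
apply: (@C2_on_sub _ _ setT) => //.
exact (has_jet2_C2 openT (@has_jet2_sqdist _ _ setT a)).
Qed.

Lemma laplacian_sqdist (R : realType) (n : nat) (a x : 'rV[R]_n) :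
  laplacian (sqdist a) x = 2 * n%:R.
Proof.
rewrite (has_jet2_laplacian openT (@has_jet2_sqdist _ _ setT a))//.
under eq_bigr do rewrite sum_mulr_delta eqxx mulr1.
by rewrite sumr_const card_ord mulr_natr.
Qed.

Lemma gradsq_sqdist (R : realType) (n : nat) (a x : 'rV[R]_n) :
  gradsq (sqdist a) x = 4 * sqdist a x.
Proof.
rewrite (has_jet2_gradsq (@has_jet2_sqdist _ _ setT a))// mulr_sumr.
by apply: eq_bigr => i _; rewrite sum_mulr_delta exprMn -natrX.
Qed.

Lemma enormB_sqdist (R : realType) (n : nat) (x a : 'rV[R]_n) :
  enorm (x - a) = Num.sqrt (sqdist a x).
Proof. by congr Num.sqrt; apply: eq_bigr => i _; rewrite !mxE. Qed.

Lemma sqdist_gt0 (R : realType) (n : nat) (a x : 'rV[R]_n) : x != a -> 0 < sqdist a x.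
Proof.
move=> xa; rewrite lt0r sumr_ge0 ?andbT => [|i _]; last exact: sqr_ge0.
apply: contra xa => /eqP s0; apply/eqP/rowP => i.
have /psumr_eq0P /(_ s0 i isT) /eqP : forall i : 'I_n, true -> 0 <= (x 0 i - a 0 i) ^+ 2.
  by move=> k _; exact: sqr_ge0.
by rewrite sqrf_eq0 subr_eq0 => /eqP.
Qed.

Lemma enorm_gt0 (R : realType) (n : nat) (a x : 'rV[R]_n) : x != a -> 0 < enorm (x - a).
Proof. by move=> xa; rewrite enormB_sqdist sqrtr_gt0 sqdist_gt0. Qed.

Section Radial.
Variables (R : realType) (n : nat) (a : 'rV[R]_n).

Lemma open_neq : open (~` [set a]).
Proof. exact/closed_openC/accessible_closed_set1/hausdorff_accessible/norm_hausdorff. Qed.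

Lemma sqdist_pos (x : 'rV[R]_n) : (~` [set a]) x -> [set t : R | 0 < t] (sqdist a x).
Proof. by move=> /eqP; exact: sqdist_gt0. Qed.

Lemma C2_on_enormB : C2_on (~` [set a]) (fun x => enorm (x - a)).
Proof.
under eq_fun do rewrite enormB_sqdist.
exact (C2_on_comp (@open_neq) (@C2_on_sqdist R n _ a) sqdist_pos (@is_derive2_on_sqrt R)).
Qed.

Lemma gradsq_enormB x : x != a -> gradsq (fun x => enorm (x - a)) x = 1.
Proof.
move=> xa; have s0 := sqdist_gt0 xa.
under eq_fun do rewrite enormB_sqdist.
rewrite (gradsq_comp (@C2_on_sqdist R n _ a) sqdist_pos (@is_derive2_on_sqrt R)); last exact/eqP.
rewrite gradsq_sqdist exprVn exprMn sqr_sqrtr ?ltW// -natrX mulVf//.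
by rewrite mulf_neq0 ?gt_eqF.
Qed.

Lemma laplacian_enormB x : x != a ->
  laplacian (fun x => enorm (x - a)) x = (n%:R - 1) / enorm (x - a).
Proof.
move=> xa; have s0 := sqdist_gt0 xa.
have r0 : Num.sqrt (sqdist a x) != 0 by rewrite gt_eqF ?sqrtr_gt0.
under eq_fun do rewrite enormB_sqdist.
rewrite (laplacian_comp open_neq (@C2_on_sqdist R n _ a) sqdist_pos (@is_derive2_on_sqrt R)); last exact/eqP.
rewrite gradsq_sqdist laplacian_sqdist enormB_sqdist; field.
by rewrite r0 gt_eqF.
Qed.

Lemma C2_on_radial (F F' F'' : R -> R) : is_derive2_on [set t | 0 < t] F F' F'' ->
  C2_on (~` [set a]) (fun x => F (enorm (x - a))).
Proof.
move=> dF; have pos x : (~` [set a]) x -> [set t : R | 0 < t] (enorm (x - a)).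
  by move=> /eqP; exact: enorm_gt0.
exact (C2_on_comp open_neq C2_on_enormB pos dF).
Qed.

Lemma laplacian_radial (F F' F'' : R -> R) x :
  is_derive2_on [set t | 0 < t] F F' F'' -> x != a ->
  laplacian (fun x => F (enorm (x - a))) x =
  F'' (enorm (x - a)) + F' (enorm (x - a)) * ((n%:R - 1) / enorm (x - a)).
Proof.
move=> dF xa; rewrite (laplacian_comp open_neq C2_on_enormB _ dF); last exact/eqP.
  by rewrite gradsq_enormB// laplacian_enormB// mulr1.
by move=> y /eqP; exact: enorm_gt0.
Qed.

End Radial.

Lemma gradsqZ (R : realType) (n : nat) (U : set 'rV[R]_n) (c : R) (u : 'rV[R]_n -> R) x :
  C2_on U u -> U x -> gradsq (fun x => c * u x) x = c ^+ 2 * gradsq u x.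
Proof.
move=> /C2_onP Ju Ux; rewrite (has_jet2_gradsq (has_jet2Z c Ju))// mulr_sumr.
by apply: eq_bigr => i _; rewrite exprMn.
Qed.

(** * The comparison principle *)

(** If [d < 0], then [g'] is negative just to the right of the critical point [0],
    so [g] decreases there. *)
Lemma second_derivative_min_ge0 (R : realType) (g g' : R -> R) (d e : R) :
  0 < e -> (forall t : R, `|t| < e -> is_derive t (1 : R) g (g' t)) ->
  is_derive (0 : R) (1 : R) g' d ->
  (forall t : R, `|t| < e -> g 0 <= g t) -> 0 <= d.
Proof.
move=> e0 dg [dg' dE] gmin; rewrite leNgt; apply/negP => d0.
have in_e (t : R) : t \in `]-e, e[ -> `|t| < e by rewrite in_itv /= -ltr_norml.
have g'0 : g' 0 = 0.
  have D0 : is_derive (0 : R) (1 : R) g 0.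
    apply: (@derive1_at_min R g (-e) e 0).
    - by rewrite ge0_cp// ltW.
    - by move=> t /in_e /dg[].
    - by rewrite in_itv /= oppr_lt0 e0.
    - by move=> t /in_e/gmin.
  have e00 : `|0 : R| < e by rewrite normr0.
  by have [_ <-] := dg 0 e00; have [_ ->] := D0.
have cv : h^-1 *: (g' (h *: (1 : R) + 0) - g' 0) @[h --> (0 : R)^'] --> d.
  by move: dE; rewrite /derive => <-; exact: dg'.
have : \forall h \near (0 : R), h != 0 -> h^-1 *: (g' (h *: (1 : R) + 0) - g' 0) < 0.
  exact: cvgr_lt cv _ d0.
move=> /nbhs_ballP[e2 /= e20 neg].
pose h0 := Num.min e e2 / 2.
have m0 : 0 < Num.min e e2 by rewrite lt_min e0.
have [h00 h0e h0e2] : [/\ 0 < h0, h0 < e & h0 < e2].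
  have : Num.min e e2 <= e /\ Num.min e e2 <= e2 by rewrite !ge_min !lexx orbT.
  by rewrite /h0; split; lra.
have small (t : R) : 0 <= t <= h0 -> `|t| < e by case/andP => ? ?; rewrite ger0_norm//; lra.
have [||c + E] := @MVT R g g' 0 h0 h00.
- move=> t; rewrite in_itv /= => /andP[t0 th]; apply: dg.
  by apply: small; rewrite !ltW.
- apply/continuous_in_subspaceT => t /set_mem /=; rewrite in_itv /= => /small/dg[dt _].
  exact/differentiable_continuous/derivable1_diffP.
rewrite in_itv /= => /andP[c0 ch].
have gh : g 0 <= g h0 by apply/gmin/small; rewrite lexx ltW.
have := neg c; rewrite /ball /= sub0r normrN gtr0_norm// => /(_ (lt_trans ch h0e2)).
rewrite gt_eqF// => /(_ isT); rewrite g'0 subr0 addr0 [_ *: 1]mulr1 /GRing.scale /=.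
rewrite pmulr_rlt0 ?invr_gt0// => g'c.
have : g' c * (h0 - 0) < 0 by rewrite subr0 nmulr_rlt0.
by rewrite -E; lra.
Qed.

Lemma line_continuous (R : realType) (V : normedModType R) (x w : V) (t : R) :
  {for t, continuous (fun t : R => t *: w + x)}.
Proof. by apply: continuousD; [exact: scalel_continuous|exact: cst_continuous]. Qed.

Lemma near_line (R : realType) (V : normedModType R) (x : V) (P : set V) :
  (\forall y \near x, P y) ->
  forall w : V, exists2 e : R, 0 < e & forall t : R, `|t| < e -> P (t *: w + x).
Proof.
move=> Px w.
have : \forall t \near (0 : R), P (t *: w + x).
  by apply: line_continuous; rewrite /= scale0r add0r.
move=> /nbhs_ballP[e /= e0 eP]; exists e => // t te; apply: eP.
by rewrite /ball /= sub0r normrN.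
Qed.

Lemma C2_on_is_derive (R : realType) (n : nat) (U : set 'rV[R]_n) u x i :
  C2_on U u -> U x -> is_derive x (delta_mx 0 i) u (pderiv i u x) /\
    is_derive x (delta_mx 0 i) (pderiv i u) (pderiv i (pderiv i u) x).
Proof. by move=> /C2_onP J /J[]. Qed.

Lemma laplacian_min_ge0 (R : realType) (n : nat) (U : set 'rV[R]_n)
    (v : 'rV[R]_n -> R) (x : 'rV[R]_n) :
  open U -> C2_on U v -> U x -> (\forall y \near x, v x <= v y) ->
  0 <= laplacian v x.
Proof.
move=> oU Cv Ux vmin; apply: sumr_ge0 => i _.
have nb : \forall y \near x, U y /\ v x <= v y.
  by apply: filterI => //; exact: (open_nbhs_nbhs (conj oU Ux)).
have [e e0 eP] := near_line nb (delta_mx 0 i).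
pose g (t : R) := v (t *: delta_mx 0 i + x).
pose g' (t : R) := pderiv i v (t *: delta_mx 0 i + x).
have dg (t : R) : `|t| < e -> is_derive t (1 : R) g (g' t).
  move=> /eP[Ut _]; have [D _] := C2_on_is_derive i Cv Ut.
  exact (iffLR (is_derive_line_at v x _ t _) D).
have dg' : is_derive (0 : R) (1 : R) g' (pderiv i (pderiv i v) x).
  have [_ D] := C2_on_is_derive i Cv Ux.
  exact (iffLR (is_derive_line (pderiv i v) x _ _) D).
have gmin (t : R) : `|t| < e -> g 0 <= g t.
  by move=> /eP[_]; rewrite /g scale0r add0r.
exact (second_derivative_min_ge0 e0 dg dg' gmin).
Qed.

(** Where [u] falls below [w - th] it cannot be minimal relative to [w], because
    there [u - w] is strictly superharmonic. *)
Lemma comparison_principle (R : realType) (n : nat) (U A : set 'rV[R]_n)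
    (u w : 'rV[R]_n -> R) (th : R) :
  open U -> A `<=` U -> compact A -> C2_on U u -> C2_on U w ->
  (forall x, A x -> u x < w x - th ->
     nbhs x A /\ laplacian u x < laplacian w x) ->
  forall x, A x -> w x - th <= u x.
Proof.
move=> oU AU cA Cu Cw H x Ax; rewrite leNgt; apply/negP => ux.
pose v y := u y + -1 * w y.
have CNw := C2_onZ oU (-1) Cw.
have Cv : C2_on U v := C2_onD oU Cu CNw.
have cv : {within A, continuous v}.
  by apply/continuous_in_subspaceT => y /set_mem /AU Uy; have [] := Cv y Uy.
have [c /set_mem Ac cmin] := compact_EVT_min (ex_intro _ x Ax) cA cv.
have vc : v c < - th.
  by apply: le_lt_trans (cmin x (mem_set Ax)) _; rewrite /v; lra.
have [|cA' lapc] := H c Ac; first by move: vc; rewrite /v; lra.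
have Uc := AU _ Ac.
suff : 0 <= laplacian v c.
  by rewrite (laplacianD oU Cu CNw Uc) (laplacianZ oU (-1) Cw Uc) mulN1r subr_ge0 leNgt lapc.
apply: (laplacian_min_ge0 oU Cv Uc).
apply: filterS cA' => y Ay; apply: cmin; exact: mem_set.
Qed.

(** * The Euclidean norm and distance *)

Lemma enorm_ge0 (R : realType) (n : nat) (x : 'rV[R]_n) : 0 <= enorm x.
Proof. exact: sqrtr_ge0. Qed.

Lemma enorm_sqr (R : realType) (n : nat) (x : 'rV[R]_n) :
  enorm x ^+ 2 = \sum_(i < n) x 0 i ^+ 2.
Proof. by rewrite sqr_sqrtr// sumr_ge0// => i _; exact: sqr_ge0. Qed.

Lemma enorm_coord (R : realType) (n : nat) (x : 'rV[R]_n) (i : 'I_n) :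
  `|x 0 i| <= enorm x.
Proof.
rewrite -sqrtr_sqr ler_wsqrtr// (bigD1 i)//= lerDl sumr_ge0// => k _.
exact: sqr_ge0.
Qed.

Lemma norm_le_enorm (R : realType) (n : nat) (x : 'rV[R]_n) : `|x| <= enorm x.
Proof.
rewrite [`|x|]mx_normrE; apply: bigmax_le => [|[k i] _ /=]; first exact: enorm_ge0.
by rewrite (ord1 k) enorm_coord.
Qed.

Lemma enorm_delta (R : realType) (n : nat) (i : 'I_n) (c : R) :
  enorm (c *: delta_mx 0 i : 'rV[R]_n) = `|c|.
Proof.
rewrite -sqrtr_sqr; congr Num.sqrt; rewrite (bigD1 i)//= big1 => [|k /negPf ki].
  by rewrite !mxE !eqxx mulr1 addr0.
by rewrite !mxE eqxx ki mulr0 expr0n.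
Qed.

Lemma enormN (R : realType) (n : nat) (x : 'rV[R]_n) : enorm (- x) = enorm x.
Proof. by congr Num.sqrt; apply: eq_bigr => i _; rewrite mxE sqrrN. Qed.

Lemma enorm0 (R : realType) (n : nat) : enorm (0 : 'rV[R]_n) = 0.
Proof. by rewrite /enorm big1 ?sqrtr0// => i _; rewrite mxE expr0n. Qed.

Lemma enorm_eq0 (R : realType) (n : nat) (x : 'rV[R]_n) : enorm x = 0 -> x = 0.
Proof.
move=> x0; apply/rowP => i; rewrite mxE; apply/eqP; rewrite -normr_eq0.
by rewrite eq_le normr_ge0 andbT -x0 enorm_coord.
Qed.

(** The Cauchy-Schwarz inequality, summing the inequality of arithmetic and
    geometric means for the coordinates of the two rescaled vectors. *)
Lemma enorm_dot_le (R : realType) (n : nat) (x y : 'rV[R]_n) :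
  \sum_(i < n) x 0 i * y 0 i <= enorm x * enorm y.
Proof.
have [/eqP/enorm_eq0 ->|x0] := boolP (enorm x == 0).
  by rewrite enorm0 mul0r big1// => i _; rewrite mxE mul0r.
have [/eqP/enorm_eq0 ->|y0] := boolP (enorm y == 0).
  by rewrite enorm0 mulr0 big1// => i _; rewrite mxE mulr0.
have {x0}X : 0 < enorm x by rewrite lt0r x0 enorm_ge0.
have {y0}Y : 0 < enorm y by rewrite lt0r y0 enorm_ge0.
have XY : 0 < enorm x * enorm y by rewrite mulr_gt0.
rewrite -(ler_pM2l XY) mulr_sumr -[leRHS]expr2 exprMn.
have -> : enorm x ^+ 2 * enorm y ^+ 2 =
    \sum_(i < n) ((enorm y * x 0 i) ^+ 2 + (enorm x * y 0 i) ^+ 2) / 2.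
  rewrite -mulr_suml big_split /=.
  under eq_bigr do rewrite exprMn; rewrite -mulr_sumr -enorm_sqr.
  under eq_bigr do rewrite exprMn; rewrite -mulr_sumr -enorm_sqr.
  by field.
apply: ler_sum => i _.
have := sqr_ge0 (enorm y * x 0 i - enorm x * y 0 i); rewrite sqrrB.
move: (enorm x) (enorm y) (x 0 i) (y 0 i) => a b c d; nra.
Qed.

Lemma enormD (R : realType) (n : nat) (x y : 'rV[R]_n) :
  enorm (x + y) <= enorm x + enorm y.
Proof.
rewrite -(@ler_pXn2r R 2)// ?nnegrE ?addr_ge0 ?enorm_ge0//.
have -> : enorm (x + y) ^+ 2 =
    enorm x ^+ 2 + (\sum_(i < n) x 0 i * y 0 i) * 2 + enorm y ^+ 2.
  rewrite !enorm_sqr mulr_suml -!big_split /=.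
  by apply: eq_bigr => i _; rewrite mxE; ring.
by rewrite sqrrD lerD2r lerD2l -[leRHS]mulr_natr ler_pM2r// enorm_dot_le.
Qed.

Lemma enormB_triangle (R : realType) (n : nat) (y x z : 'rV[R]_n) :
  enorm (x - z) <= enorm (x - y) + enorm (y - z).
Proof. by rewrite -[x - z](subrKA y); exact: enormD. Qed.

Lemma enormBC (R : realType) (n : nat) (x y : 'rV[R]_n) : enorm (x - y) = enorm (y - x).
Proof. by rewrite -enormN opprB. Qed.

Lemma enormB_continuous (R : realType) (n : nat) (a : 'rV[R]_n) :
  continuous (fun x : 'rV[R]_n => enorm (x - a)).
Proof.
move=> x; under eq_fun do rewrite enormB_sqdist.
have cs : {for x, continuous (sqdist a)}.
  by have [] := @C2_on_sqdist R n setT a x I.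
exact: (@continuous_comp _ _ _ (sqdist a) Num.sqrt x cs (@sqrt_continuous _ _)).
Qed.

Lemma eball_open (R : realType) (n : nat) (a : 'rV[R]_n) (r : R) :
  open [set x : 'rV[R]_n | enorm (x - a) < r].
Proof.
have := @open_comp 'rV[R]_n R (fun x => enorm (x - a)) [set t : R | t < r].
by apply; [move=> x _; exact: enormB_continuous|exact: open_lt].
Qed.

Lemma eball_closed (R : realType) (n : nat) (a : 'rV[R]_n) (r : R) :
  closed [set x : 'rV[R]_n | enorm (x - a) <= r].
Proof.
have := @preimage_closed 'rV[R]_n R (fun x => enorm (x - a)) [set t : R | t <= r].
by apply; [move=> x _; exact: enormB_continuous|exact: closed_le].
Qed.

Lemma eball_nbhs (R : realType) (n : nat) (a : 'rV[R]_n) (r : R) : 0 < r ->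
  \forall x \near a, enorm (x - a) < r.
Proof.
move=> r0; have ra : [set x : 'rV[R]_n | enorm (x - a) < r] a.
  by rewrite /= subrr enorm0.
by apply: open_nbhs_nbhs; split => //; exact: eball_open.
Qed.

Lemma nbhs_eball (R : realType) (n : nat) (a : 'rV[R]_n) (P : set 'rV[R]_n) :
  (\forall x \near a, P x) ->
  exists2 r : R, 0 < r & forall x, enorm (x - a) < r -> P x.
Proof.
move=> /nbhs_ballP[r /= r0 rP]; exists r => // x xr; apply: rP.
rewrite -ball_normE /= distrC; apply: le_lt_trans xr; exact: norm_le_enorm.
Qed.

Lemma eball_compact (R : realType) (n : nat) (a : 'rV[R]_n) (r : R) :
  compact [set x : 'rV[R]_n | enorm (x - a) <= r].
Proof.
apply: bounded_closed_compact; last exact: eball_closed.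
exists (r + `|a|); split; first exact: num_real.
move=> M rM x /= xr; rewrite -[x](subrK a); apply: le_trans (ler_normD _ _) _.
apply: le_trans (ltW rM); rewrite lerD2r; apply: le_trans xr; exact: norm_le_enorm.
Qed.

Lemma compact_in_eball (R : realType) (n : nat) (a : 'rV[R]_n) (K : set 'rV[R]_n) :
  compact K -> exists2 r : R, 0 < r & forall x, K x -> enorm (x - a) < r.
Proof.
move=> cK; have [->|/set0P K0] := eqVneq K set0; first by exists 1.
have cn : {within K, continuous (fun x : 'rV[R]_n => enorm (x - a))}.
  by apply/continuous_in_subspaceT => x _; exact: enormB_continuous.
have [c _ cmax] := compact_EVT_max K0 cK cn.
exists (enorm (c - a) + 1); first by rewrite ltr_wpDl ?enorm_ge0.
by move=> x Kx; rewrite (le_lt_trans (cmax x (mem_set Kx)))// ltrDl.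
Qed.

Section Distance.
Variables (R : realType) (n : nat) (B : set 'rV[R]_n).

Lemma edist_set_le x y : B y -> edist_set x B <= enorm (x - y).
Proof.
move=> By; apply: ge_inf; last by exists y.
by exists 0 => _ [z _ <-]; exact: enorm_ge0.
Qed.

Lemma edist_set_ge x (c : R) : B !=set0 ->
  (forall y, B y -> c <= enorm (x - y)) -> c <= edist_set x B.
Proof.
move=> [y By] cB; apply: lb_le_inf; first by exists (enorm (x - y)); exists y.
by move=> _ [z Bz <-]; exact: cB.
Qed.

Lemma edist_set_gt0 x : B !=set0 -> closed B -> ~ B x -> 0 < edist_set x B.
Proof.
move=> B0 cB Bx; have : \forall y \near x, ~ B y.
  by apply: open_nbhs_nbhs; split => //; exact: closed_openC.
move=> /nbhs_eball[r r0 rB]; apply: (lt_le_trans r0).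
apply: edist_set_ge => // y By; rewrite leNgt; apply/negP => xy.
by apply: (rB y) => //; rewrite enormBC.
Qed.

End Distance.

(** * Components and boundaries *)

Lemma closed_boundary (T : topologicalType) (K : set T) : closed (boundary K).
Proof.
rewrite /boundary setDE; apply: closedI; first exact: closed_closure.
exact/open_closedC/open_interior.
Qed.

Lemma boundary_sub (T : topologicalType) (K : set T) : closed K -> boundary K `<=` K.
Proof. by move=> cK x [+ _]; rewrite -(iffLR (closure_id K) cK). Qed.

(** The other components are finitely many closed sets that miss [p]. *)
Lemma near_connected_component (T : topologicalType) (K : set T) (p : T) :
  closed K -> finite_set (components K) -> K p ->
  \forall x \near p, K x -> connected_component K p x.
Proof.
move=> cK fK Kp.
pose F := components K `\ connected_component K p.
have cF : closed (\bigcup_(C in F) C).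
  apply: closed_bigcup; first exact: finite_setD.
  by move=> _ [[y _ <-] _]; exact: component_closed.
have Fp : (~` \bigcup_(C in F) C) p.
  move=> [_ [[y Ky <-] /= yp] /same_connected_component E].
  by apply: yp; rewrite E.
have : \forall x \near p, (~` \bigcup_(C in F) C) x.
  by apply: open_nbhs_nbhs; split => //; exact: closed_openC.
apply: filterS => x Fx Kx; apply: contrapT => xp; apply: Fx.
exists (connected_component K x); last exact: connected_component_refl.
split; first by exists x.
by move=> E; apply: xp; rewrite -E; exact: connected_component_refl.
Qed.

(** Otherwise [A] would be closed as well, and by connectedness it would contain a
    whole line. *)
Lemma bounded_open_boundary (R : realType) (n : nat) (i : 'I_n) (A : set 'rV[R]_n) (r : R) :
  A !=set0 -> open A -> (forall x, A x -> enorm x < r) -> boundary A !=set0.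
Proof.
move=> [q Aq] oA Ar; apply: contrapT => bA.
have cA : closed A.
  move=> x clx; apply: contrapT => Ax; apply: bA; exists x; split => //.
  by move=> /interior_subset.
pose l (t : R) : 'rV[R]_n := t *: delta_mx 0 i + q.
have cl : continuous l.
  by move=> t; exact: line_continuous.
have TE : l @^-1` A = [set: R].
  have cT : connected [set: R] by apply/connected_intervalP => a b _ _ c _.
  apply: cT.
  - by exists 0; rewrite /l /= scale0r add0r.
  - exists (l @^-1` A); last by rewrite setTI.
    by have := @open_comp R 'rV[R]_n l A; apply => // t _; exact: cl.
  - exists (l @^-1` A); last by rewrite setTI.
    by have := @preimage_closed R 'rV[R]_n l A; apply => // t _; exact: cl.
have : (l @^-1` A) (r + enorm q) by rewrite TE.
move=> /Ar; rewrite /l => lt_r.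
have := enormD ((r + enorm q) *: delta_mx 0 i + q) (- q).
rewrite addrK enorm_delta enormN.
have := ler_norm (r + enorm q); lra.
Qed.

Lemma is_derive_abs_le (R : realType) (H h : R -> R) (k : R) :
  (forall t : R, 0 <= t <= 1 -> is_derive t (1 : R) H (h t)) ->
  (forall t : R, 0 <= t <= 1 -> `|h t| <= k) -> `|H 1 - H 0| <= k.
Proof.
move=> dH hk; rewrite ler_norml; apply/andP; split.
  have dN (t : R) : 0 <= t <= 1 -> is_derive t (1 : R) (fun t => - H t) (- h t).
    by move=> /dH dt; exact: is_deriveN.
  have := @is_derive_increment_le R (fun t => - H t) (fun t => - h t) 0 1 k ler01 dN.
  rewrite subr0 mulr1 opprK lerNl opprB addrC; apply => t /hk.
  by rewrite -normrN; apply: le_trans; exact: ler_norm.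
have := @is_derive_increment_le R H h 0 1 k ler01 dH.
rewrite subr0 mulr1; apply.
by move=> t /hk; apply: le_trans; exact: ler_norm.
Qed.

Lemma C2_on_locally_lipschitz (R : realType) (n : nat) (u : 'rV[R]_n -> R) (p : 'rV[R]_n) :
  C2_on setT u ->
  exists2 c : R, 0 < c & exists2 r : R, 0 < r & forall x y,
    enorm (x - p) < r -> enorm (y - p) < r -> `|u x - u y| <= c * enorm (x - y).
Proof.
move=> Cu.
pose M := 1 + \sum_(i < n) `|pderiv i u p|.
have M1 : 1 <= M by rewrite lerDl sumr_ge0.
have near_bound i : \forall x \near p, `|pderiv i u x| <= M.
  have [_ /(_ i)[_ ci] _] := Cu p Logic.I.
  have cn : {for p, continuous (fun x => `|pderiv i u x|)}.
    exact: (@continuous_comp _ _ _ _ (fun t : R => `|t|) p ci (@norm_continuous _ _ _)).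
  have lt_M : `|pderiv i u p| < M.
    by rewrite /M (bigD1 i)//= addrA ltr_wpDr ?sumr_ge0// ltrDr.
  by apply: filterS (cvgr_lt _ cn _ lt_M) => x /ltW.
have := @filter_forall _ _ _ _ (nbhs_filter p) near_bound.
move=> /nbhs_ballP[r /= r0 rM].
exists (M * n%:R + 1); first by rewrite ltr_wpDl// mulr_ge0// (le_trans ler01).
exists r => // x y xp yp.
(* The path from [x] to [y] changes one coordinate at a time, so it stays in the
   cube around [p]. *)
pose z (k : nat) : 'rV[R]_n := \row_j (if (j < k)%N then y 0 j else x 0 j).
have z0 : z 0%N = x by apply/rowP => j; rewrite !mxE.
have zn : z n = y by apply/rowP => j; rewrite !mxE ltn_ord.
have step (k : 'I_n) : `|u (z k.+1) - u (z k)| <= M * enorm (x - y).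
  pose s := y 0 k - x 0 k.
  have zE : z k.+1 = s *: delta_mx 0 k + z k.
    apply/rowP => j; rewrite !mxE eqxx /= ltnS leq_eqVlt.
    have [->|/negPf jk] := eqVneq j k; first by rewrite eqxx ltnn mulr1 /s subrK.
    by rewrite (_ : (j == k :> nat) = false)//= mulr0 add0r.
  have sE : `|s| <= enorm (x - y).
    by rewrite enormBC; have := enorm_coord (y - x) k; rewrite !mxE.
  have cube (t : R) : 0 <= t <= 1 ->
      forall i, `|pderiv i u ((s * t) *: delta_mx 0 k + z k)| <= M.
    move=> /andP[t0 t1]; apply: rM; rewrite -ball_normE /= distrC [`|_|]mx_normrE.
    apply/bigmax_ltP; split => // -[a j] _ /=; rewrite (ord1 a) !mxE eqxx /=.
    have := enorm_coord (x - p) j; have := enorm_coord (y - p) j; rewrite !mxE.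
    move=> /le_lt_trans/(_ yp) yj /le_lt_trans/(_ xp) xj.
    have [jk|jk] := eqVneq j k; last by rewrite mulr0 add0r; case: ifP.
    rewrite {j}jk in xj yj *; rewrite ltnn mulr1 /s.
    have -> : (y 0 k - x 0 k) * t + x 0 k - p 0 k =
        (1 - t) * (x 0 k - p 0 k) + t * (y 0 k - p 0 k) by ring.
    apply: le_lt_trans (ler_normD _ _) _.
    rewrite !normrM (ger0_norm t0) (@ger0_norm _ (1 - t)) ?subr_ge0//.
    pose m := Num.max `|x 0 k - p 0 k| `|y 0 k - p 0 k|.
    apply: (@le_lt_trans _ _ ((1 - t) * m + t * m)); last first.
      by rewrite -mulrDl subrK mul1r /m gt_max xj.
    by rewrite lerD ?ler_wpM2l ?subr_ge0// /m le_max lexx ?orbT.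
  have dline (t : R) : is_derive t (1 : R) (fun h : R => u (h *: delta_mx 0 k + z k))
      (pderiv k u (t *: delta_mx 0 k + z k)).
    have Ut : [set: 'rV[R]_n] (t *: delta_mx 0 k + z k) by [].
    have [D _] := C2_on_is_derive k Cu Ut.
    exact (iffLR (is_derive_line_at u (z k) _ t _) D).
  have dst (t : R) : is_derive t (1 : R) (fun t : R => s * t) s.
    by apply: is_derive_eq; rewrite /GRing.scale /= mulr1.
  have := @is_derive_abs_le R _ _ (M * enorm (x - y))
    (fun t _ => is_derive1_comp (dline (s * t)) (dst t)).
  rewrite /= mulr1 mulr0 -zE scale0r add0r; apply => t /cube/(_ k) bk.
  by rewrite normrM ler_pM.
have path k : (k <= n)%N -> `|u (z k) - u (z 0%N)| <= k%:R * (M * enorm (x - y)).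
  elim: k => [|k IH] kn; first by rewrite subrr normr0 mul0r.
  rewrite -(subrKA (u (z k))); apply: le_trans (ler_normD _ _) _.
  rewrite -natr1 mulrDl mul1r [leRHS]addrC.
  by apply: lerD; [exact: (step (Ordinal kn))|exact/IH/ltnW].
rewrite distrC -zn -z0 (le_trans (path n (leqnn n)))// zn z0.
by rewrite mulrA [n%:R * M]mulrC ler_wpM2r ?enorm_ge0// lerDl.
Qed.

(** * Flattening a boundary point *)

Lemma col'_continuous (R : realType) (n : nat) (i : 'I_n) :
  continuous (col' i : 'rV[R]_n -> 'rV[R]_n.-1).
Proof.
move=> x; apply/(@cvgrPdist_lt _ _ _ (nbhs x) (nbhs_filter x) (col' i) (col' i x)) => e e0.
have := nbhsx_ballx x e e0; apply: filterS => y; rewrite -ball_normE /=.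
apply: le_lt_trans; rewrite [leLHS]mx_normrE; apply: bigmax_le => // -[a k] _ /=.
rewrite (ord1 a) !mxE.
have : `|(x - y) 0 (lift i k)| <= `|x - y|.
  rewrite [leRHS]mx_normrE.
  exact: (@le_bigmax _ _ _ 0 (fun q : 'I_1 * 'I_n => `|(x - y) q.1 q.2|) (0, lift i k)).
by rewrite !mxE.
Qed.

Section GraphFunction.
Variables (R : realType) (n : nat) (i : 'I_n).
Implicit Types (g : 'rV[R]_n.-1 -> R).

Lemma is_derive_col'_lift (g : 'rV[R]_n.-1 -> R) (x : 'rV[R]_n) (k : 'I_n.-1) (dg : R) :
  is_derive (col' i x) (delta_mx 0 k) g dg ->
  is_derive x (delta_mx 0 (lift i k)) (fun y => g (col' i y)) dg.
Proof.
move=> D; apply: (iffRL (is_derive_line (fun y => g (col' i y)) x _ dg)).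
have E : (fun h : R => g (col' i (h *: delta_mx 0 (lift i k) + x))) =
         (fun h : R => g (h *: delta_mx 0 k + col' i x)).
  apply/funext => h; congr g; apply/rowP => m; rewrite !mxE eqxx /=.
  by rewrite (inj_eq lift_inj).
by rewrite E; exact (iffLR (is_derive_line g (col' i x) _ dg) D).
Qed.

Lemma is_derive_col'_self (g : 'rV[R]_n.-1 -> R) (x : 'rV[R]_n) :
  is_derive x (delta_mx 0 i) (fun y => g (col' i y)) 0.
Proof.
apply: (iffRL (is_derive_line (fun y => g (col' i y)) x _ 0)).
have E : (fun h : R => g (col' i (h *: delta_mx 0 i + x))) = (fun=> g (col' i x)).
  apply/funext => h; congr g; apply/rowP => m; rewrite !mxE eqxx /=.
  by rewrite eq_sym (negPf (neq_lift i m)) mulr0 add0r.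
by rewrite E; exact: is_derive_cst.
Qed.

Lemma has_jet2_col' g : C2_on setT g ->
  has_jet2 setT (fun x : 'rV[R]_n => g (col' i x))
    (fun j x => if unlift i j is Some k then pderiv k g (col' i x) else 0)
    (fun j l x => if unlift i j is Some k then
       (if unlift i l is Some m then pderiv m (pderiv k g) (col' i x) else 0) else 0).
Proof.
move=> Cg x _; have [cg d1 d2] := Cg (col' i x) Logic.I.
have cc (h : 'rV[R]_n.-1 -> R) : {for col' i x, continuous h} ->
    {for x, continuous (fun y => h (col' i y))}.
  by move=> ch; exact: (@continuous_comp _ _ _ _ h x (@col'_continuous R n i x) ch).
split.
- exact: cc.
- move=> j; case: unliftP => [k ->|->]; last exact: is_derive_col'_self.
  by apply: is_derive_col'_lift; case: (d1 k) => /derivableP.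
- move=> j; case: unliftP => [k _|_]; last exact: cst_continuous.
  by apply: cc; case: (d1 k).
- move=> j l; case: (unliftP i j) => [k _|_]; last exact: is_derive_cst.
  case: (unliftP i l) => [m ->|->]; last exact: is_derive_col'_self.
  by apply: is_derive_col'_lift; case: (d2 k m) => /derivableP.
- move=> j l; case: (unliftP i j) => [k _|_]; last exact: cst_continuous.
  case: (unliftP i l) => [m _|_]; last exact: cst_continuous.
  by apply: cc; case: (d2 k m).
Qed.

Variables (b : bool) (g : 'rV[R]_n.-1 -> R).
Hypothesis Cg : C2_on setT g.

(** Positive on the side of the graph that lies outside the epigraph. *)
Definition graph_gap (x : 'rV[R]_n) : R := g (col' i x) - (-1) ^+ b * x 0 i.

Let graph_gapE : graph_gap = fun x => g (col' i x) + - (-1) ^+ b * (x 0 i - 0).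
Proof. by apply/funext => x; rewrite /graph_gap subr0 mulNr. Qed.

Let graph_gap_jet :=
  has_jet2D (has_jet2_col' Cg) (has_jet2Z (- (-1) ^+ b) (@has_jet2_coord R n setT i 0)).

Lemma C2_on_graph_gap : C2_on setT graph_gap.
Proof. by rewrite graph_gapE; exact (has_jet2_C2 openT graph_gap_jet). Qed.

Lemma gradsq_graph_gap_ge1 x : 1 <= gradsq graph_gap x.
Proof.
rewrite /gradsq (bigD1 i)//= -[leLHS]addr0 lerD//; last first.
  by apply: sumr_ge0 => k _; exact: sqr_ge0.
rewrite graph_gapE (has_jet2_pderiv i graph_gap_jet)// unlift_none add0r eqxx mulr1.
by rewrite sqrrN sqrr_sign.
Qed.

Lemma graph_gap_line (t : R) x :
  graph_gap (t *: ((-1) ^+ b *: delta_mx 0 i) + x) = graph_gap x - t.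
Proof.
rewrite /graph_gap !mxE !eqxx mulr1.
have -> : col' i (t *: ((-1) ^+ b *: delta_mx 0 i) + x) = col' i x.
  apply/rowP => m; rewrite !mxE eqxx /=.
  by rewrite eq_sym (negPf (neq_lift i m)) !mulr0 add0r.
by rewrite mulrDr mulrCA -expr2 sqrr_sign mulr1 opprD addrA addrAC.
Qed.

End GraphFunction.

(** Near [p] the function [e] replaces the distance to the boundary, which need
    not be of class C^2: it is comparable with the distance outside [K], has no
    critical point, and is strictly superharmonic. *)
Definition flattens (R : realType) (n : nat) (K : set 'rV[R]_n) (p : 'rV[R]_n)
    (e : 'rV[R]_n -> R) (c : R) : Prop :=
  [/\ C2_on setT e, e p = 0 &
    \forall x \near p, [/\ K x <-> e x <= 0, 4^-1 <= gradsq e x <= c,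
      1 <= - laplacian e x <= c &
      ~ K x -> e x <= c * edist_set x (boundary K) /\
               edist_set x (boundary K) <= c * e x]].

Lemma near_closure_graph (R : realType) (n : nat) (D : set 'rV[R]_n) (p : 'rV[R]_n)
    (i : 'I_n) (b : bool) (g : 'rV[R]_n.-1 -> R) (r : R) :
  C2_on setT g ->
  (forall x, enorm (x - p) < r -> (D x <-> g (col' i x) < (-1) ^+ b * x 0 i)) ->
  forall x, enorm (x - p) < r -> (closure D x <-> graph_gap i b g x <= 0).
Proof.
move=> Cg DE x xr; set d := graph_gap i b g.
have DE' y : enorm (y - p) < r -> (D y <-> d y < 0).
  by move=> /DE; rewrite /d /graph_gap subr_lt0.
have near_r : \forall y \near x, enorm (y - p) < r.
  by apply: open_nbhs_nbhs; split => //; exact: eball_open.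
split.
  move=> clx; rewrite leNgt; apply/negP => dx.
  have cd : {for x, continuous d} by have [] := C2_on_graph_gap i b Cg (Logic.I : setT x).
  have near_pos : \forall y \near x, 0 < d y by exact: cvgr_gt cd _ dx.
  have [y [Dy [yr dy]]] := clx _ (filterI near_r near_pos).
  by have := iffLR (DE' y yr) Dy; rewrite ltNge ltW.
rewrite le_eqVlt => /orP[/eqP d0|dx]; last by apply/subset_closure/DE'.
move=> B nB.
have [e e0 eP] := near_line (filterI near_r nB) ((-1) ^+ b *: delta_mx 0 i).
have [e2 e2e] : `|e / 2| < e /\ 0 < e / 2 by rewrite gtr0_norm ?divr_gt0//; split; lra.
have [yr By] := eP _ e2; exists ((e / 2) *: ((-1) ^+ b *: delta_mx 0 i) + x); split => //.
by apply/DE' => //; rewrite /d graph_gap_line -/d d0 sub0r oppr_lt0.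
Qed.

(** Moving along the distinguished axis by [graph_gap x] leads from [x] to a point
    of the graph, which is a boundary point. *)
Lemma edist_boundary_le_gap (R : realType) (n : nat) (K : set 'rV[R]_n) (p : 'rV[R]_n)
    (i : 'I_n) (b : bool) (g : 'rV[R]_n.-1 -> R) (r : R) :
  (forall x, enorm (x - p) < r -> (K x <-> graph_gap i b g x <= 0)) ->
  forall x, enorm (x - p) < r / 2 -> 0 <= graph_gap i b g x < r / 2 ->
  edist_set x (boundary K) <= graph_gap i b g x.
Proof.
set d := graph_gap i b g => KE x xr /andP[d0 dr].
pose w : 'rV[R]_n := (-1) ^+ b *: delta_mx 0 i.
pose y := d x *: w + x.
have xy : enorm (x - y) = d x.
  rewrite enormBC /y addrK /w scalerA enorm_delta normrM.
  by rewrite ger0_norm// normrX normrN1 expr1n mulr1.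
have dy : d y = 0 by rewrite /y /w /d graph_gap_line subrr.
have yr : enorm (y - p) < r.
  by have := enormB_triangle x y p; rewrite [enorm (y - x)]enormBC xy; lra.
rewrite -[leRHS]xy; apply: edist_set_le; split.
  by apply: subset_closure; apply/KE; rewrite // dy.
move=> iK.
have near_r : \forall z \near y, enorm (z - p) < r.
  by apply: open_nbhs_nbhs; split => //; exact: eball_open.
have [e e0 eP] := near_line (filterI near_r iK) w.
have e2 : `|- (e / 2)| < e by rewrite normrN gtr0_norm ?divr_gt0//; lra.
have [zr Kz] := eP _ e2.
have := iffLR (KE _ zr) Kz; rewrite /d /w graph_gap_line -/d dy sub0r opprK.
by rewrite leNgt divr_gt0.
Qed.

Lemma near_le_bound (R : realType) (T : topologicalType) (p : T) (h : T -> R) (M : R) :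
  {for p, continuous h} -> h p < M -> \forall x \near p, h x <= M.
Proof. by move=> ch hM; apply: filterS (cvgr_lt _ ch _ hM) => x /ltW. Qed.

(** The estimates for [t - 2 L t^2] when [A], [l] and [t] are the squared gradient,
    the Laplacian and the value of the gap function. *)
Lemma quadratic_correction (R : realType) (L G A l t : R) :
  1 <= L -> 1 <= A -> A <= G -> `|l| <= L -> `|t| <= (8 * L)^-1 ->
  [/\ 4^-1 <= (1 - 4 * L * t) ^+ 2 * A <= 3 * G,
      1 <= - (- (4 * L) * A + (1 - 4 * L * t) * l) <= 4 * L * G + 2 * L,
      (t - 2 * L * t ^+ 2 <= 0) = (t <= 0),
      0 < t -> t <= 2 * (t - 2 * L * t ^+ 2) &
      0 < t -> t - 2 * L * t ^+ 2 <= 2 * t /\ t - 2 * L * t ^+ 2 <= 1].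
Proof.
move=> L1 A1 AG; rewrite ler_norml => /andP[l1 l2] t8.
have L0 : 0 < L by lra.
have t8' : `|t| <= 8^-1.
  by apply: (le_trans t8); rewrite lef_pV2 ?posrE; lra.
have : `|4 * L * t| <= 2^-1.
  rewrite normrM ger0_norm; last lra.
  have -> : (2^-1 : R) = 4 * L * (8 * L)^-1 by field; rewrite gt_eqF//; lra.
  by rewrite ler_wpM2l//; lra.
rewrite ler_norml => /andP[].
have -> : t - 2 * L * t ^+ 2 = t * (1 - 2^-1 * (4 * L * t)) by field.
move: (4 * L * t) => q q1 q2.
split.
- have aux (m : R) : 4^-1 <= m -> m <= 3 -> 4^-1 <= m * A <= 3 * G.
    move=> m1 m2; have mA : (m - 4^-1) * (A - 1) >= 0 by rewrite mulr_ge0 ?subr_ge0.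
    have mG : (3 - m) * A >= 0 by rewrite mulr_ge0 ?subr_ge0// (le_trans ler01).
    by apply/andP; split; lra.
  by apply: aux; nra.
- have LA : L <= L * A by rewrite ler_peMr// ltW.
  have LG : L * A <= L * G by rewrite ler_wpM2l// ltW.
  have [p1 p2] : 0 <= 1 - q /\ 1 - q <= 2 by split; lra.
  have /andP[x1 x2] : - (2 * L) <= (1 - q) * l <= 2 * L.
    rewrite -ler_norml normrM (ger0_norm p1); apply: ler_pM => //.
    by rewrite ler_norml l1.
  by apply/andP; split; lra.
- by rewrite pmulr_lle0//; lra.
- by move=> t0; nra.
- move=> t0; move: t8'; rewrite gtr0_norm// => t8'.
  by split; nra.
Qed.

(** Away from the other components, [K] near [p] is the closed region on one side
    of a graph. *)
Lemma component_local_graph (R : realType) (n : nat) (K D : set 'rV[R]_n) (p : 'rV[R]_n) :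
  closed K -> finite_set (components K) -> K p ->
  connected_component K p = closure D -> C2_domain D -> boundary D p ->
  exists i b (g : 'rV[R]_n.-1 -> R) r, [/\ 0 < r, C2_on setT g,
    graph_gap i b g p = 0 &
    forall x, enorm (x - p) < r -> (K x <-> graph_gap i b g x <= 0)].
Proof.
move=> cK fK Kp ccD [_ oD _ bD] Dp.
have [r0 [i [b [g [r0_gt0 Cg DE]]]]] := bD p Dp.
have cD := near_closure_graph Cg DE.
have [r1 r1_gt0 r1P] := nbhs_eball (near_connected_component cK fK Kp).
pose r := Num.min r0 r1.
have r_gt0 : 0 < r by rewrite lt_min r0_gt0.
have KE x : enorm (x - p) < r -> (K x <-> graph_gap i b g x <= 0).
  rewrite lt_min => /andP[x0 x1]; rewrite -(cD x x0) -ccD; split; first exact: r1P.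
  exact: connected_component_sub.
exists i, b, g, r; split => //.
have pr : enorm (p - p) < r by rewrite subrr enorm0.
apply/eqP; rewrite eq_le (iffLR (KE p pr) Kp) leNgt; apply/negP => dp.
have [_ iDp] := Dp; apply: iDp; apply: open_nbhs_nbhs; split => //.
apply/DE; first by rewrite subrr enorm0.
by move: dp; rewrite /graph_gap subr_lt0.
Qed.

(** The graph passes through [p], and the points just below it are outside [K]. *)
Lemma component_boundary (R : realType) (n : nat) (K D : set 'rV[R]_n) (p : 'rV[R]_n) :
  closed K -> finite_set (components K) -> K p ->
  connected_component K p = closure D -> C2_domain D -> boundary D p ->
  boundary K p.
Proof.
move=> cK fK Kp ccD CD Dp; split; first exact: subset_closure.
have [i [b [g [r [r0 Cg dp KE]]]]] := component_local_graph cK fK Kp ccD CD Dp.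
move=> iK.
have [e e0 eP] := near_line (filterI (eball_nbhs p r0) iK) ((-1) ^+ b *: delta_mx 0 i).
have e2 : `|- (e / 2)| < e by rewrite normrN gtr0_norm ?divr_gt0//; lra.
have [zr Kz] := eP _ e2.
have := iffLR (KE _ zr) Kz; rewrite graph_gap_line dp sub0r opprK.
by rewrite leNgt divr_gt0.
Qed.

(** Take [e = d - 2 L d^2] with [d] the graph gap and [L] a local bound for its
    Laplacian. As the gradient of [d] has length at least [1], the quadratic term
    contributes at most [- 4 L] to the Laplacian and fixes its sign. The upper
    bound of [e] by the distance is the Lipschitz property, because [e <= 0] at
    the boundary points near [p]. *)
Lemma flattens_exists (R : realType) (n : nat) (K D : set 'rV[R]_n) (p : 'rV[R]_n) :
  closed K -> finite_set (components K) -> K p -> ~ interior K p ->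
  connected_component K p = closure D -> C2_domain D ->
  exists e c, 0 < c /\ flattens K p e c.
Proof.
move=> cK fK Kp iKp ccD CD.
have DK : closure D `<=` K by rewrite -ccD; exact: connected_component_sub.
have Dp : boundary D p.
  split; first by rewrite -ccD; exact: connected_component_refl.
  move=> iDp; apply: iKp; apply: filterS iDp => y Dy; apply: DK.
  exact: subset_closure.
have [i [b [g [r [r_gt0 Cg dp KE]]]]] := component_local_graph cK fK Kp ccD CD Dp.
set d := graph_gap i b g in dp KE *.
have Cd : C2_on setT d := @C2_on_graph_gap R n i b g Cg.
pose L := `|laplacian d p| + 1.
pose G := gradsq d p + 1.
have L1 : 1 <= L by rewrite /L lerDr.
pose h (t : R) := t - 2 * L * t ^+ 2.
have dh : is_derive2_on setT h (fun t => 1 - 4 * L * t) (fun=> - (4 * L)).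
  move=> t _; split; last exact: cst_continuous.
    by apply: is_derive_eq; rewrite /GRing.scale /=; ring.
  by apply: is_derive_eq; rewrite /GRing.scale /=; ring.
pose e x := h (d x).
have inT x : [set: 'rV[R]_n] x -> [set: R] (d x) by [].
have Ce : C2_on setT e by exact (C2_on_comp openT Cd inT dh).
have [Lam Lam0 [r2 r2_gt0 lip]] := C2_on_locally_lipschitz p Ce.
have ep : e p = 0 by rewrite /e /h dp; ring.
pose m := Num.min r r2.
have m_gt0 : 0 < m by rewrite lt_min r_gt0.
pose c := 2 + 3 * G + 4 * L * G + 2 * L + Lam + 2 / m.
have G1 : 1 <= G by rewrite /G lerDr; apply: sumr_ge0 => k _; exact: sqr_ge0.
have mi : 0 < 2 / m by rewrite divr_gt0.
have LG : L * G >= 0 by rewrite mulr_ge0// (le_trans ler01).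
have [c3G c4G c2 cLam cm] :
    [/\ 3 * G <= c, 4 * L * G + 2 * L <= c, 2 <= c, Lam <= c & 2 / m <= c].
  have aux (a v l s q : R) : 0 <= a -> 1 <= v -> 1 <= l -> 0 < s -> 0 < q ->
      let c := 2 + 3 * v + 4 * a + 2 * l + s + q in
      [/\ 3 * v <= c, 4 * a + 2 * l <= c, 2 <= c, s <= c & q <= c].
    by move=> ? ? ? ? ? /=; split; lra.
  by rewrite /c -[4 * L * G]mulrA; exact: aux.
have r_r : r / 2 < r by rewrite ltr_pdivrMr// ltr_pMr// ltr1n.
have r2_r2 : r2 / 2 < r2 by rewrite ltr_pdivrMr// ltr_pMr// ltr1n.
have c0 : 0 < c by rewrite (lt_le_trans _ c2).
exists e, c; split => //.
split=> //.
have cd : {for p, continuous d} by have [] := Cd p Logic.I.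
have cad : {for p, continuous (fun x => `|d x|)}.
  exact: (@continuous_comp _ _ _ d (fun t : R => `|t|) p cd (@norm_continuous _ _ _)).
have clap : {for p, continuous (fun x => `|laplacian d x|)}.
  exact: (@continuous_comp _ _ _ (laplacian d) (fun t : R => `|t|) p
    (C2_on_continuous_laplacian Cd Logic.I) (@norm_continuous _ _ _)).
have nG : \forall x \near p, gradsq d x <= G.
  by apply: near_le_bound; [exact: (C2_on_continuous_gradsq Cd)|rewrite /G ltrDl].
have nL : \forall x \near p, `|laplacian d x| <= L.
  by apply: near_le_bound clap _; rewrite /L ltrDl.
have nd : \forall x \near p, `|d x| <= (8 * L)^-1.
  apply: near_le_bound cad _; rewrite dp normr0 invr_gt0; lra.
have nd2 : \forall x \near p, `|d x| <= r / 4.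
  by apply: near_le_bound cad _; rewrite dp normr0 divr_gt0.
have r_2 : 0 < r / 2 by rewrite divr_gt0.
have r2_2 : 0 < r2 / 2 by rewrite divr_gt0.
have nx := eball_nbhs p r_2; have nx2 := eball_nbhs p r2_2.
near=> x.
have gG : gradsq d x <= G by near: x.
have lL : `|laplacian d x| <= L by near: x.
have d8 : `|d x| <= (8 * L)^-1 by near: x.
have dr : `|d x| <= r / 4 by near: x.
have xr : enorm (x - p) < r / 2 by near: x.
have xr2 : enorm (x - p) < r2 / 2 by near: x.
have [qg ql qs qd qe] :=
  quadratic_correction L1 (gradsq_graph_gap_ge1 i b Cg x) gG lL d8.
have ge : gradsq e x = (1 - 4 * L * d x) ^+ 2 * gradsq d x.
  exact: (gradsq_comp Cd inT dh Logic.I).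
have le : laplacian e x = - (4 * L) * gradsq d x + (1 - 4 * L * d x) * laplacian d x.
  exact: (laplacian_comp openT Cd inT dh Logic.I).
have KEx := KE x (lt_trans xr r_r).
have e_le0 : (e x <= 0) = (d x <= 0) by exact: qs.
split.
- by rewrite e_le0.
- by rewrite ge; case/andP: qg => -> /= qg; exact: le_trans qg c3G.
- by rewrite le; case/andP: ql => -> /= ql; exact: le_trans ql c4G.
move=> Kx {ge le qg ql gG lL}.
have dx : 0 < d x by rewrite ltNge; apply/negP => /KEx.
have ex : 0 < e x by rewrite ltNge e_le0 -ltNge.
have de : d x <= 2 * e x := qd dx.
have [ed e1] : e x <= 2 * d x /\ e x <= 1 := qe dx.
have dist_le : edist_set x (boundary K) <= d x.
  apply: (edist_boundary_le_gap KE) => //; rewrite -/d ltW//=.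
  move: dr; rewrite gtr0_norm// => dr; rewrite (le_lt_trans dr)//.
  by rewrite ltr_pM2l// ltf_pV2 ?posrE// ltr_nat.
split; last first.
  by apply: (le_trans dist_le); apply: (le_trans de); rewrite ler_wpM2r// ltW.
have bK : boundary K !=set0.
  by exists p; split => //; exact: subset_closure.
rewrite mulrC -ler_pdivrMr//.
apply: edist_set_ge => // y [].
rewrite -(iffLR (closure_id K) cK) => Ky _; rewrite ler_pdivrMr// mulrC.
have [yr|yr] := ltP (enorm (y - p)) m.
  move: yr; rewrite lt_min => /andP[yr yr2].
  have ey : e y <= 0.
    have dy := iffLR (KE y yr) Ky; rewrite /e /h subr_le0 (le_trans dy)//.
    by rewrite mulr_ge0 ?sqr_ge0// mulr_ge0// (le_trans ler01).
  have exy : e x <= Lam * enorm (x - y).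
    apply: le_trans (lip x y (lt_trans xr2 r2_r2) yr2).
    by rewrite (le_trans _ (ler_norm _))// lerDl oppr_ge0.
  by apply: le_trans exy _; rewrite ler_wpM2r ?enorm_ge0.
have xm : enorm (x - p) < m / 2.
  have [E|E] : m = r \/ m = r2 by rewrite /m; case: leP => _; [left|right].
    by rewrite E.
  by rewrite E.
have xy : m / 2 <= enorm (x - y).
  have := enormB_triangle x y p; rewrite [enorm (y - x)]enormBC.
  have aux (a1 a2 a3 v : R) : v <= a1 -> a1 <= a2 + a3 -> a3 < v / 2 -> v / 2 <= a2.
    by lra.
  by move=> tri; exact: aux yr tri xm.
apply: (le_trans e1).
have -> : 1 = 2 / m * (m / 2) by field; rewrite gt_eqF.
by apply: ler_pM => //; rewrite ltW// divr_gt0.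
Unshelve. all: by end_near. Qed.

(** [|x - p|^2] made superharmonic outside [K] by the strict superharmonicity of
    [e]; it separates [p] from the rest of the boundary. *)
Definition localizer (R : realType) (n : nat) (p : 'rV[R]_n) (e : 'rV[R]_n -> R)
    (x : 'rV[R]_n) : R :=
  sqdist p x + 2 * n%:R * e x.

Lemma C2_on_localizer (R : realType) (n : nat) (p : 'rV[R]_n) (e : 'rV[R]_n -> R) :
  C2_on setT e -> C2_on setT (localizer p e).
Proof.
move=> Ce; have Ce' := C2_onZ openT (2 * n%:R) Ce.
exact (C2_onD openT (@C2_on_sqdist R n setT p) Ce').
Qed.

Lemma laplacian_localizer (R : realType) (n : nat) (p x : 'rV[R]_n) (e : 'rV[R]_n -> R) :
  C2_on setT e ->
  laplacian (localizer p e) x = 2 * n%:R * (1 + laplacian e x).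
Proof.
move=> Ce; have Ce' := C2_onZ openT (2 * n%:R) Ce.
rewrite (laplacianD openT (@C2_on_sqdist R n setT p) Ce')//.
by rewrite laplacian_sqdist (laplacianZ openT _ Ce)// mulrDr mulr1.
Qed.

Lemma localizer_ge (R : realType) (n : nat) (p x : 'rV[R]_n) (e : 'rV[R]_n -> R) :
  0 <= e x -> enorm (x - p) ^+ 2 <= localizer p e x.
Proof.
move=> e0; rewrite enormB_sqdist sqr_sqrtr.
  by rewrite lerDl !mulr_ge0.
by apply: sumr_ge0 => i _; exact: sqr_ge0.
Qed.

Lemma localizer_small (R : realType) (n : nat) (p : 'rV[R]_n) (e : 'rV[R]_n -> R) (c : R) :
  C2_on setT e -> e p = 0 -> 0 < c -> \forall x \near p, localizer p e x <= c.
Proof.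
move=> Ce ep c0.
have cl : {for p, continuous (localizer p e)} by have [] := @C2_on_localizer R n p e Ce p Logic.I.
apply: near_le_bound cl _; rewrite /localizer ep mulr0 addr0 /sqdist big1// => i _.
by rewrite subrr expr0n.
Qed.

(** * One-dimensional profiles built from a second primitive *)

Section Profiles.
Variables (R : realType) (phi A P : R -> R).
Hypothesis phi_cont : forall t : R, 0 < t -> {for t, continuous phi}.
Hypothesis phi_pos : forall t : R, 0 < t -> 0 < phi t.
Hypothesis phi_noninc : forall s t : R, 0 < s -> s <= t -> phi t <= phi s.
Hypothesis dA : forall t : R, 0 < t -> is_derive t (1 : R) A (phi t).
Hypothesis dP : forall t : R, 0 < t -> is_derive t (1 : R) P (A t).

Lemma primitive_increment (a b : R) : 0 < a -> a <= b ->
  phi b * (b - a) <= A b - A a <= phi a * (b - a).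
Proof.
move=> a0 ab; have dAab (t : R) : a <= t <= b -> is_derive t (1 : R) A (phi t).
  by move=> /andP[at_ _]; apply: dA; exact: lt_le_trans at_.
apply/andP; split; last first.
  apply: (is_derive_increment_le ab dAab) => t /andP[at_ _].
  exact: phi_noninc.
have dN (t : R) : a <= t <= b -> is_derive t (1 : R) (fun t => - A t) (- phi t).
  by move=> /dAab dt; exact: is_deriveN.
have bound (t : R) : a <= t <= b -> - phi t <= - phi b.
  move=> /andP[at_ tb]; rewrite lerN2; apply: phi_noninc tb.
  exact: lt_le_trans at_.
by have := is_derive_increment_le ab dN bound; lra.
Qed.

Lemma primitive_ge0 (a b : R) : 0 < a -> a <= b -> 0 <= A b - A a.
Proof.
move=> a0 ab; have /andP[+ _] := primitive_increment a0 ab; apply: le_trans.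
by rewrite mulr_ge0 ?subr_ge0// ltW// phi_pos// (lt_le_trans a0).
Qed.

(** A primitive of [t * phi t], as integration by parts shows. *)
Definition moment (t : R) : R := t * A t - P t.

Lemma is_derive_moment (t : R) : 0 < t -> is_derive t (1 : R) moment (t * phi t).
Proof.
move=> t0; have dAt := dA t0; have dPt := dP t0.
by apply: is_derive_eq; rewrite /GRing.scale /=; ring.
Qed.

Lemma moment_nondecr (a b : R) : 0 < a -> a <= b -> moment a <= moment b.
Proof.
move=> a0 ab; apply: (@ge0_is_derive_le R moment (fun t => t * phi t) a b ab).
  by move=> t /andP[at_ _]; apply: is_derive_moment; exact: lt_le_trans at_.
move=> t /andP[at_ _]; have t0 := lt_le_trans a0 at_.
by rewrite mulr_ge0// ltW// phi_pos.
Qed.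

(** A radial profile whose derivative is [1/n] times the integral of [phi] over
    [[r, 2r]]. That integral lies between [r * phi (2 r)] and [r * phi r], so the
    Laplacian of the profile in dimension [n] is at most [phi], while the profile
    still grows like [moment]. *)
Definition tail (n : nat) (r : R) : R := n%:R^-1 * (2^-1 * P (2 * r) - P r).
Definition tail' (n : nat) (r : R) : R := n%:R^-1 * (A (2 * r) - A r).
Definition tail'' (n : nat) (r : R) : R := n%:R^-1 * (2 * phi (2 * r) - phi r).

Lemma is_derive_scale (F F' : R -> R) (c t : R) :
  is_derive (c * t) (1 : R) F (F' (c * t)) ->
  is_derive t (1 : R) (fun s => F (c * s)) (c * F' (c * t)).
Proof.
move=> dF; have dc : is_derive t (1 : R) (fun s : R => c * s) c.
  by apply: is_derive_eq; rewrite /GRing.scale /= mulr1.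
by rewrite mulrC; exact (is_derive1_comp dF dc).
Qed.

Lemma continuous_scale (F : R -> R) (c t : R) :
  {for c * t, continuous F} -> {for t, continuous (fun s => F (c * s))}.
Proof.
move=> cF; apply: (@continuous_comp _ _ _ (fun s => c * s) F t _ cF).
by apply: continuousM; [exact: cst_continuous|exact: cvg_id].
Qed.

Lemma is_derive2_on_tail n : is_derive2_on [set t | 0 < t] (tail n) (tail' n) (tail'' n).
Proof.
move=> t /= t0; have t20 : 0 < 2 * t by rewrite mulr_gt0.
have dA2 := is_derive_scale (dA t20); have dP2 := is_derive_scale (dP t20).
have dAt := dA t0; have dPt := dP t0.
split.
- rewrite /tail /tail'; apply: is_derive_eq; rewrite /GRing.scale /=.
  by rewrite mulrA mulVf ?mul1r.
- by rewrite /tail' /tail''; apply: is_derive_eq.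
- apply: continuousM; first exact: cst_continuous.
  apply: continuousB; last exact: phi_cont.
  apply: continuousM; first exact: cst_continuous.
  by apply: continuous_scale; exact: phi_cont.
Qed.

Lemma tail'_bounds n (r : R) : (0 < n)%N -> 0 < r ->
  n%:R^-1 * (r * phi (2 * r)) <= tail' n r <= n%:R^-1 * (r * phi r).
Proof.
move=> n0 r0; have r2 : r <= 2 * r by lra.
have := primitive_increment r0 r2; rewrite (_ : 2 * r - r = r); last by ring.
by rewrite /tail' !ler_pM2l ?invr_gt0 ?ltr0n// ![r * _]mulrC.
Qed.

Lemma tail'_ge0 n (r : R) : (0 < n)%N -> 0 < r -> 0 <= tail' n r.
Proof.
move=> n0 r0; have /andP[+ _] := tail'_bounds n0 r0; apply: le_trans.
by rewrite mulr_ge0 ?invr_ge0 ?ler0n// mulr_ge0 ?ltW// phi_pos// mulr_gt0.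
Qed.

Lemma tail_radial_laplacian_le n (r : R) : (0 < n)%N -> 0 < r ->
  tail'' n r + tail' n r * ((n%:R - 1) / r) <= phi r.
Proof.
move=> n0 r0; have n1 : 1 <= n%:R :> R by rewrite ler1n.
have /andP[_ t'] := tail'_bounds n0 r0.
have p2 : phi (2 * r) <= phi r by apply: phi_noninc; lra.
apply: (@le_trans _ _ (n%:R^-1 * phi r + n%:R^-1 * (r * phi r) * ((n%:R - 1) / r))).
  apply: lerD; last by rewrite ler_wpM2r// divr_ge0 ?subr_ge0// ltW.
  by rewrite /tail'' ler_wpM2l ?invr_ge0 ?ler0n//; lra.
rewrite le_eqVlt; apply/orP; left; apply/eqP; field.
by rewrite !gt_eqF ?ltr0n.
Qed.

Lemma tail_nondecr n (a b : R) : (0 < n)%N -> 0 < a -> a <= b -> tail n a <= tail n b.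
Proof.
move=> n0 a0 ab; apply: (@ge0_is_derive_le R (tail n) (tail' n) a b ab).
  by move=> t /andP[at_ _]; have [] := is_derive2_on_tail n (lt_le_trans a0 at_).
by move=> t /andP[at_ _]; apply: tail'_ge0 => //; exact: lt_le_trans at_.
Qed.

Lemma tail_ge_moment n (a b : R) : (0 < n)%N -> 0 < a -> a <= b ->
  (4 * n%:R)^-1 * (moment (2 * b) - moment (2 * a)) <= tail n b - tail n a.
Proof.
move=> n0 a0 ab; have nn : n%:R != 0 :> R by rewrite pnatr_eq0 -lt0n.
have d (t : R) : a <= t <= b -> is_derive t (1 : R)
    (fun t => tail n t - (4 * n%:R)^-1 * moment (2 * t))
    (tail' n t - n%:R^-1 * (t * phi (2 * t))).
  move=> /andP[at_ _]; have t0 := lt_le_trans a0 at_.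
  have [d1 _ _] := is_derive2_on_tail n t0.
  have t20 : 0 < 2 * t by rewrite mulr_gt0.
  have d2 := is_derive_scale (F' := fun t => t * phi t) (is_derive_moment t20).
  by apply: is_derive_eq; rewrite /GRing.scale /=; field.
have pos (t : R) : a <= t <= b -> 0 <= tail' n t - n%:R^-1 * (t * phi (2 * t)).
  move=> /andP[at_ _]; rewrite subr_ge0.
  by have /andP[] := tail'_bounds n0 (lt_le_trans a0 at_).
have aux (u v x y : R) : u - x <= v - y -> y - x <= v - u by lra.
by rewrite mulrBr; apply: aux; exact: ge0_is_derive_le ab d pos.
Qed.

(** The solution of [psi'' t = - phi (t + eps)], [psi 0 = 0], [psi' 1 = 0]. The
    shift by [eps] keeps it bounded when [t * phi t] is not integrable at [0]. *)
Definition layer (eps t : R) : R := t * A (1 + eps) - P (t + eps) + P eps.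
Definition layer' (eps t : R) : R := A (1 + eps) - A (t + eps).
Definition layer'' (eps t : R) : R := - phi (t + eps).

Lemma is_derive_translate (F F' : R -> R) (c t : R) :
  is_derive (t + c) (1 : R) F (F' (t + c)) ->
  is_derive t (1 : R) (fun s => F (s + c)) (F' (t + c)).
Proof.
move=> dF; have dc : is_derive t (1 : R) (fun s : R => s + c) 1.
  by apply: is_derive_eq; rewrite addr0.
by rewrite -[F' _]mulr1; exact (@is_derive1_comp R F (fun s => s + c) t _ 1 dF dc).
Qed.

Lemma is_derive2_on_layer eps :
  is_derive2_on [set t | 0 < t + eps] (layer eps) (layer' eps) (layer'' eps).
Proof.
move=> t /= t0; have dAt := is_derive_translate (dA t0).
have dPt := is_derive_translate (dP t0).
split.
- rewrite /layer /layer'; apply: is_derive_eq; rewrite /GRing.scale /=; ring.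
- by rewrite /layer' /layer''; apply: is_derive_eq; rewrite add0r mul1r.
- apply: continuousN; have ct : {for t, continuous (fun s => s + eps)}.
    by apply: continuousD; [exact: cvg_id|exact: cst_continuous].
  exact: (@continuous_comp _ _ _ (fun s => s + eps) phi t ct (phi_cont t0)).
Qed.

Lemma layer'_bounds eps (t : R) : 0 < eps -> 0 <= t <= 1 ->
  0 <= layer' eps t <= phi (t + eps).
Proof.
move=> e0 /andP[t0 t1]; have te : 0 < t + eps by rewrite ltr_wpDl.
have le : t + eps <= 1 + eps by rewrite lerD2r.
rewrite /layer' primitive_ge0//=.
have /andP[_] := primitive_increment te le; move=> /le_trans; apply.
rewrite -[leRHS]mulr1 ler_pM2l ?phi_pos//; lra.
Qed.

Lemma layer0 eps : layer eps 0 = 0.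
Proof. by rewrite /layer mul0r !add0r addNr. Qed.

Lemma layer_derive_itv eps (a b : R) : 0 < eps -> 0 <= a ->
  forall t, a <= t <= b -> is_derive t (1 : R) (layer eps) (layer' eps t).
Proof.
move=> e0 a0 t /andP[at_ _]; have te : 0 < t + eps by lra.
by have [] := is_derive2_on_layer te.
Qed.

Lemma layer_nondecr eps (a b : R) : 0 < eps -> 0 <= a -> a <= b -> b <= 1 ->
  layer eps a <= layer eps b.
Proof.
move=> e0 a0 ab b1; apply: (ge0_is_derive_le ab (layer_derive_itv e0 a0)).
move=> t /andP[at_ tb].
have t01 : 0 <= t <= 1 by apply/andP; split; lra.
by have /andP[] := layer'_bounds e0 t01.
Qed.

Lemma layer_increment eps (a b k : R) : 0 < eps -> 0 <= a -> a <= b -> b <= 1 ->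
  phi (a + eps) <= k -> layer eps b - layer eps a <= k * (b - a).
Proof.
move=> e0 a0 ab b1 pk.
apply: (is_derive_increment_le ab (layer_derive_itv e0 a0)) => t /andP[at_ tb].
have t01 : 0 <= t <= 1 by apply/andP; split; lra.
have /andP[_ l] := layer'_bounds e0 t01.
apply: (le_trans l); apply: le_trans pk; apply: phi_noninc; lra.
Qed.

(** [layer eps 1] is the integral of [(s - eps) * phi s] over [[eps, 1 + eps]], and
    [s - eps >= s / 2] beyond [2 eps]. *)
Lemma layer1_ge_moment eps : 0 < eps -> 2 * eps <= 1 ->
  (moment 1 - moment (2 * eps)) / 2 <= layer eps 1.
Proof.
move=> e0 e1.
pose H t := moment t - eps * A t.
have dH (t : R) : 0 < t -> is_derive t (1 : R) H ((t - eps) * phi t).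
  move=> t0; have d1 := is_derive_moment t0; have d2 := dA t0.
  by apply: is_derive_eq; rewrite /GRing.scale /= mulrBl.
have HE : layer eps 1 = H (1 + eps) - H eps by rewrite /layer /H /moment; ring.
have H1 : H eps <= H (2 * eps).
  have le : eps <= 2 * eps by lra.
  apply: (@ge0_is_derive_le R H (fun t => (t - eps) * phi t) _ _ le).
    by move=> t /andP[t1 _]; apply: dH; exact: lt_le_trans t1.
  by move=> t /andP[t1 _]; rewrite mulr_ge0 ?subr_ge0// ltW// phi_pos// (lt_le_trans e0).
have H3 : H 1 <= H (1 + eps).
  have le : 1 <= 1 + eps by lra.
  apply: (@ge0_is_derive_le R H (fun t => (t - eps) * phi t) _ _ le).
    by move=> t /andP[t1 _]; apply: dH; exact: lt_le_trans t1.
  move=> t /andP[t1 _]; rewrite mulr_ge0 ?subr_ge0//; first lra.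
  by rewrite ltW// phi_pos// (lt_le_trans ltr01).
have H2 : H (2 * eps) - 2^-1 * moment (2 * eps) <= H 1 - 2^-1 * moment 1.
  have dD (t : R) : 2 * eps <= t <= 1 -> is_derive t (1 : R)
      (fun t => H t - 2^-1 * moment t) ((t - eps) * phi t - 2^-1 * (t * phi t)).
    move=> /andP[t1 _]; have t0 : 0 < t by lra.
    have d1 := dH t t0; have d2 := is_derive_moment t0; exact: is_derive_eq.
  apply: (ge0_is_derive_le e1 dD) => t /andP[t1 _].
  rewrite mulrA -mulrBl mulr_ge0//; first lra.
  by rewrite ltW// phi_pos//; lra.
rewrite HE; move: (H _) (H _) (H _) (H _) H1 H2 H3 => *; lra.
Qed.

Lemma is_derive2_on_layer0 :
  is_derive2_on [set t | 0 < t] (layer 0) (layer' 0) (layer'' 0).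
Proof. by move=> t t0; apply: is_derive2_on_layer; rewrite /= addr0. Qed.

(** With [C' = r^2 phi] and [I] an upper bound of [moment], the potential
    [C / r + (I - moment)] of dimension three has derivative [- C / r^2]. It is
    decreasing, hence remains a supersolution in higher dimensions. *)
Lemma newton_profile (M : R) :
  (forall a b : R, 0 < a -> a < b -> moment b - moment a <= M) ->
  exists F F' F'' : R -> R, [/\ is_derive2_on [set t | 0 < t] F F' F'',
    forall r : R, 0 < r -> 0 <= F r &
    forall n (r : R), (3 <= n)%N -> 0 < r ->
      phi r <= - (F'' r + F' r * ((n%:R - 1) / r))].
Proof.
move=> HM.
pose c2 (t : R) := t ^+ 2 * phi t.
have cc2 (t : R) : 0 < t -> {for t, continuous c2}.
  move=> t0; apply: continuousM; last exact: phi_cont.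
  exact: exprn_continuous.
have [C dC] := antiderivative_pos cc2.
have M0 : 0 <= M.
  have := HM 1 2 ltr01; rewrite ltr1n => /(_ isT); apply: le_trans.
  by rewrite subr_ge0 moment_nondecr// ler1n.
have momM (t : R) : 0 < t -> moment 1 - M <= moment t <= moment 1 + M.
  move=> t0; case: (ltgtP t 1) => [t1|t1|->].
  - have := HM t 1 t0 t1; have := moment_nondecr t0 (ltW t1).
    by move=> *; apply/andP; split; lra.
  - have := HM 1 t ltr01 t1; have := moment_nondecr ltr01 (ltW t1).
    by move=> *; apply/andP; split; lra.
  - by apply/andP; split; lra.
have C_lb (t : R) : 0 < t -> C 1 - M <= C t.
  move=> t0; have [t1|t1] := leP t 1.
    have dD (s : R) : t <= s <= 1 -> is_derive s (1 : R)
        (fun s => moment s - C s) (s * phi s - s ^+ 2 * phi s).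
      move=> /andP[ts _]; have s0 := lt_le_trans t0 ts.
      have d1 := is_derive_moment s0; have d2 := dC s s0; exact: is_derive_eq.
    have pos (s : R) : t <= s <= 1 -> 0 <= s * phi s - s ^+ 2 * phi s.
      move=> /andP[ts s1]; have s0 := lt_le_trans t0 ts.
      rewrite -mulrBl mulr_ge0 ?(ltW (phi_pos s0))// subr_ge0 expr2.
      by rewrite ler_piMl// ltW.
    have aux (a b c d : R) : a - c <= b - d -> b - M <= a -> d - M <= c by lra.
    have /andP[mt _] := momM t t0.
    by apply: aux mt; exact: ge0_is_derive_le t1 dD pos.
  apply: (@le_trans _ _ (C 1)); first by rewrite lerBlDr lerDl.
  apply: (@ge0_is_derive_le R C c2 _ _ (ltW t1)).
    by move=> s /andP[s1 _]; apply: dC; exact: lt_le_trans s1.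
  move=> s /andP[s1 _]; rewrite mulr_ge0 ?sqr_ge0// ltW// phi_pos//.
  exact: lt_le_trans s1.
pose k := C 1 - M; pose I := moment 1 + M.
exists (fun r => (C r - k) / r + (I - moment r)).
exists (fun r => - ((C r - k) / r ^+ 2)).
exists (fun r => - phi r + 2 * ((C r - k) / r ^+ 3)).
split.
- move=> r /= r0; have dCr := dC r r0; have dmr := is_derive_moment r0.
  have r_n0 : r != 0 by rewrite gt_eqF.
  have dV := is_derive_invr r0; have dV2 := is_derive_invr_sqr r0.
  split.
  + by apply: is_derive_eq; rewrite /GRing.scale /= /c2; field.
  + by apply: is_derive_eq; rewrite /GRing.scale /= /c2; field.
  + have cC : {for r, continuous C}.
      by have [dd _] := dC r r0; exact/differentiable_continuous/derivable1_diffP.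
    apply: continuousD; first by apply: continuousN; exact: phi_cont.
    apply: continuousM; first exact: cst_continuous.
    apply: continuousM; first by apply: continuousB => //; exact: cst_continuous.
    by apply: continuousV; rewrite ?expf_neq0//; exact: exprn_continuous.
- move=> r r0; rewrite addr_ge0 ?divr_ge0 ?(ltW r0) ?subr_ge0 ?C_lb//.
  by have /andP[] := momM r r0.
- move=> n r n3 r0; have Ck : 0 <= C r - k by rewrite subr_ge0; exact: C_lb.
  have n3' : 3 <= n%:R :> R by rewrite ler_nat.
  have D0 : 0 <= (C r - k) / r ^+ 3 by rewrite divr_ge0// exprn_ge0// ltW.
  have -> : - ((C r - k) / r ^+ 2) * ((n%:R - 1) / r) =
      - ((C r - k) / r ^+ 3) * (n%:R - 1) by field; rewrite gt_eqF.
  move: (phi r) ((C r - k) / r ^+ 3) (n%:R : R) D0 n3' => p D m D0 m3.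
  have : 0 <= D * (m - 3) by rewrite mulr_ge0// subr_ge0.
  by lra.
Qed.

End Profiles.

(** * Necessity *)

Section Necessity.
Variables (R : realType) (N : nat) (K : set 'rV[R]_N) (f phi A P : R -> R)
  (u : 'rV[R]_N -> R).
Hypothesis hN : (3 <= N)%N.
Hypothesis cK : closed K.
Hypothesis fpos : forall t : R, 0 < t -> 0 < f t.
Hypothesis fdecr : forall s t : R, 0 < s -> s < t -> f t < f s.
Hypothesis phi_cont : forall t : R, 0 < t -> {for t, continuous phi}.
Hypothesis phi_pos : forall t : R, 0 < t -> 0 < phi t.
Hypothesis phi_noninc : forall s t : R, 0 < s -> s <= t -> phi t <= phi s.
Hypothesis dA : forall t : R, 0 < t -> is_derive t (1 : R) A (phi t).
Hypothesis dP : forall t : R, 0 < t -> is_derive t (1 : R) P (A t).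
Hypothesis Cu : C2_on (~` K) u.
Hypothesis upos : forall x, ~ K x -> 0 < u x.
Hypothesis uineq : forall x, ~ K x ->
  phi (edist_set x (boundary K)) * f (u x) <= - laplacian u x.

Let oK : open (~` K) := closed_openC cK.

(** Below the level [M] the solution is a supersolution for the datum [f M]. *)
Lemma solution_laplacian_lt x (M d k : R) : boundary K !=set0 ->
  ~ K x -> u x < M -> edist_set x (boundary K) <= d -> k <= f M ->
  laplacian u x < - (k * phi d).
Proof.
move=> bK Kx uM dd kM.
have d0 : 0 < edist_set x (boundary K).
  apply: edist_set_gt0 => //; first exact: closed_boundary.
  by move=> /(boundary_sub cK).
have pd := phi_noninc d0 dd; have pd0 := phi_pos (lt_le_trans d0 dd).
have fu := fdecr (upos Kx) uM.
rewrite ltrNr; apply: lt_le_trans (uineq Kx).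
apply: (@le_lt_trans _ _ (phi d * f M)); first by rewrite mulrC ler_wpM2l// ltW.
apply: (@lt_le_trans _ _ (phi d * f (u x))); first by rewrite ltr_pM2l.
by rewrite ler_wpM2r// ltW// fpos// upos.
Qed.

Section AtInfinity.
Variables (z : 'rV[R]_N) (r0 : R).
Hypothesis bz : boundary K z.
Hypothesis r0_gt0 : 0 < r0.
Hypothesis Kr0 : forall x, K x -> enorm (x - z) < r0.

Let N0 : (0 < N)%N. Proof. exact: leq_trans hN. Qed.

(** Nonpositive on both boundary spheres of the annulus [r0 <= r <= r1] when the
    first term is at most [M]. *)
Let W (k M r1 : R) (r : R) : R := k * (tail P N r1 - tail P N r) - M * r0 / r.

Let dW (k M r1 : R) : is_derive2_on [set t | 0 < t] (W k M r1)
  (fun r => - (k * tail' A N r) + M * r0 / r ^+ 2)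
  (fun r => - (k * tail'' phi N r) - 2 * (M * r0 / r ^+ 3)).
Proof.
move=> r /= r0'; have [d1 d2 c2] := is_derive2_on_tail phi_cont dA dP N r0'.
have r_n0 : r != 0 by rewrite gt_eqF.
have dV := is_derive_invr r0'; have dV2 := is_derive_invr_sqr r0'.
split.
- by rewrite /W; apply: is_derive_eq; rewrite /GRing.scale /=; field.
- by apply: is_derive_eq; rewrite /GRing.scale /=; field.
- apply: continuousB.
    by apply: continuousN; apply: continuousM; [exact: cst_continuous|].
  apply: continuousM; first exact: cst_continuous.
  apply: continuousM; first exact: cst_continuous.
  by apply: continuousV; rewrite ?expf_neq0//; exact: exprn_continuous.
Qed.

Lemma solution_ge_tail_barrier (M k r1 : R) : 0 < M -> 0 <= k -> k <= f M ->
  k * (tail P N r1 - tail P N r0) <= M ->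
  forall x, r0 <= enorm (x - z) <= r1 -> W k M r1 (enorm (x - z)) <= u x.
Proof.
move=> M0 k0 kf kS x xr.
pose w y := W k M r1 (enorm (y - z)).
pose An := [set y : 'rV[R]_N | r0 <= enorm (y - z) <= r1].
have Kz := boundary_sub cK bz.
have AnK : An `<=` ~` K by move=> y /andP[y0 _] /Kr0; rewrite ltNge y0.
have neqz y : (~` K) y -> y != z by move=> Ky; apply/eqP => yz; apply: Ky; rewrite yz.
have cAn : compact An.
  have -> : An = [set y | enorm (y - z) <= r1] `&` ~` [set y | enorm (y - z) < r0].
    apply/seteqP; split=> y /=; first by move=> /andP[y0 y1]; split=> //; rewrite ltNge y0.
    by move=> [y1 /negP]; rewrite -leNgt => y0; apply/andP.
  apply: compact_closedI; first exact: eball_compact.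
  exact/open_closedC/eball_open.
have Cw : C2_on (~` K) w.
  apply: (@C2_on_sub _ _ (~` [set z])); last exact (C2_on_radial (dW k M r1)).
  by move=> y /neqz /eqP.
suff H y : An y -> u y < w y - 0 -> nbhs y An /\ laplacian u y < laplacian w y.
  by rewrite -[leLHS]subr0; exact: (comparison_principle oK AnK cAn Cu Cw H).
move=> Ay; rewrite subr0 => uw; have Ky := AnK _ Ay; have uy := upos Ky.
have /andP[y0 y1] := Ay.
have ry : 0 < enorm (y - z) := lt_le_trans r0_gt0 y0.
have wM : w y < M.
  have : k * (tail P N r1 - tail P N (enorm (y - z))) <= M.
    apply: le_trans kS; rewrite ler_wpM2l// lerD2l lerN2.
    exact: tail_nondecr phi_cont phi_pos phi_noninc dA dP _ _ _ N0 r0_gt0 y0.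
  have : 0 < M * r0 / enorm (y - z) by rewrite divr_gt0// mulr_gt0.
  by rewrite /w /W; lra.
split.
- have y0' : r0 < enorm (y - z).
    rewrite lt_neqAle y0 andbT; apply/eqP => E; move: uw.
    rewrite /w /W -E mulfK ?gt_eqF//; lra.
  have y1' : enorm (y - z) < r1.
    rewrite lt_neqAle y1 andbT; apply/eqP => E; move: uw.
    rewrite /w /W E subrr mulr0 sub0r.
    have : 0 < M * r0 / r1 by rewrite -E divr_gt0// mulr_gt0.
    lra.
  have c1 : \forall v \near y, r0 < enorm (v - z).
    by exact: cvgr_gt (@enormB_continuous R N z y) _ y0'.
  have c2 : \forall v \near y, enorm (v - z) < r1.
    by exact: cvgr_lt (@enormB_continuous R N z y) _ y1'.
  by apply: filterS2 c1 c2 => v v1 v2; apply/andP; split; exact: ltW.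
- have ed : edist_set y (boundary K) <= enorm (y - z) by exact: edist_set_le.
  have := solution_laplacian_lt (ex_intro _ z bz) Ky (lt_trans uw wM) ed kf.
  move=> /lt_le_trans; apply.
  rewrite /w (laplacian_radial (dW k M r1) (neqz _ Ky)).
  have := tail_radial_laplacian_le phi_noninc dA N0 ry.
  have n3 : 3 <= N%:R :> R by rewrite ler_nat.
  move: (enorm (y - z)) (tail' A N _) (tail'' phi N _) (phi _) ry => r t1 t2 p r_gt0 tp.
  have D0 : 0 <= M * r0 / r ^+ 3 * (N%:R - 3).
    by rewrite mulr_ge0 ?subr_ge0// divr_ge0 ?exprn_ge0 ?mulr_ge0// ltW.
  have -> : - (k * t2) - 2 * (M * r0 / r ^+ 3) + (- (k * t1) + M * r0 / r ^+ 2) *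
      ((N%:R - 1) / r) = - (k * (t2 + t1 * ((N%:R - 1) / r))) +
      M * r0 / r ^+ 3 * (N%:R - 3) by field; rewrite gt_eqF.
  have : k * (t2 + t1 * ((N%:R - 1) / r)) <= k * p by rewrite ler_wpM2l.
  by lra.
Qed.

(** If [moment] were unbounded, the barrier with [k = M / S] and [S] the increment
    of [tail] would be admissible for every [M] once [r1] is large. At the distance
    [4 * r0] it exceeds [M / 2], because [S] minus the increment of [tail] over
    [[4 r0, r1]] does not depend on [r1]. So [u] would exceed every bound at one
    point. *)
Lemma moment_bounded_above : exists m : R, forall t : R, 0 < t -> moment A P t <= m.
Proof.
have r0p : 0 < r0 := r0_gt0.
apply: contrapT => unb.
have {}unb (m : R) : exists2 t : R, 0 < t & m < moment A P t.
  apply: contrapT => nm; apply: unb; exists m => t t0; rewrite leNgt; apply/negP => mt.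
  by apply: nm; exists t.
pose i0 : 'I_N := Ordinal N0.
pose x := (4 * r0) *: delta_mx 0 i0 + z.
have xz : enorm (x - z) = 4 * r0 by rewrite /x addrK enorm_delta gtr0_norm ?mulr_gt0.
have Kx : ~ K x.
  by move=> /Kr0; rewrite xz ltNge ler_peMl ?(ltW r0_gt0)// ler1n.
pose M := 2 * u x + 2.
have M0 : 0 < M by have := upos Kx; rewrite /M; lra.
have fM := fpos M0.
pose T1 := 1 + 4 * (tail P N (4 * r0) - tail P N r0) + M / f M.
have r04 : r0 <= 4 * r0 by lra.
have r40 : 0 < 4 * r0 by lra.
have t4 : 0 <= tail P N (4 * r0) - tail P N r0.
  rewrite subr_ge0.
  exact: tail_nondecr phi_cont phi_pos phi_noninc dA dP _ _ _ N0 r0_gt0 r04.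
have MfM : 0 < M / f M by rewrite divr_gt0.
have [t t0 tm] := unb (moment A P (2 * r0) + `|moment A P (8 * r0)| + `|moment A P (2 * r0)|
   + 4 * N%:R * T1).
have T1pos : 0 < T1 by rewrite /T1; lra.
have NT : 0 < 4 * N%:R * T1 by rewrite mulr_gt0// mulr_gt0// ltr0n.
have t8 : 8 * r0 < t.
  rewrite ltNge; apply/negP => t8.
  have := moment_nondecr phi_pos dA dP t0 t8.
  have := ler_norm (moment A P (8 * r0)); have := ler_norm (- moment A P (2 * r0)).
  rewrite normrN; lra.
pose r1 := t / 2.
have r1r : 4 * r0 <= r1 by rewrite /r1; lra.
have r0r1 : r0 <= r1 by lra.
pose S := tail P N r1 - tail P N r0.
have ST : T1 <= S.
  have := tail_ge_moment phi_cont phi_noninc dA dP N0 r0_gt0 r0r1.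
  rewrite (_ : 2 * r1 = t); last by rewrite /r1; field.
  apply: le_trans; rewrite ler_pdivlMl ?mulr_gt0 ?ltr0n//.
  have := normr_ge0 (moment A P (2 * r0)); have := normr_ge0 (moment A P (8 * r0)); lra.
have S0 : 0 < S := lt_le_trans T1pos ST.
have := @solution_ge_tail_barrier M (M / S) r1 M0.
have -> : 0 <= M / S by rewrite divr_ge0// ltW.
have -> : M / S <= f M.
  rewrite ler_pdivrMr// mulrC -ler_pdivrMr//; apply: le_trans ST; rewrite /T1; lra.
rewrite -/S divfK ?gt_eqF// => /(_ isT isT (lexx _) x).
rewrite xz r04 r1r => /(_ isT); rewrite /W.
have -> : M * r0 / (4 * r0) = M / 4 by field; rewrite gt_eqF.
have -> : tail P N r1 - tail P N (4 * r0) = S - (tail P N (4 * r0) - tail P N r0).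
  by rewrite /S; ring.
have : M / S * (tail P N (4 * r0) - tail P N r0) <= M / 4.
  have X4 : 4 * (tail P N (4 * r0) - tail P N r0) <= S.
    by apply: le_trans ST; rewrite /T1; lra.
  by rewrite -mulrA ler_pM2l// mulrC ler_pdivrMr//; lra.
rewrite [M / S * (S - _)]mulrBr divfK ?gt_eqF//.
move: (M / S * _) => v; rewrite /M; move: (u x) (upos Kx) => ux ux0; lra.
Qed.

End AtInfinity.

Section AtBoundary.
Variables (p : 'rV[R]_N) (e : 'rV[R]_N -> R) (c r : R).
Hypothesis bp : boundary K p.
Hypothesis c0 : 0 < c.
Hypothesis Ce : C2_on setT e.
Hypothesis ep : e p = 0.
Hypothesis r0 : 0 < r.
Hypothesis flat : forall x, enorm (x - p) < 2 * r ->
  [/\ K x <-> e x <= 0, gradsq e x <= c, 1 <= - laplacian e x <= c,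
      c * e x <= 1 & ~ K x -> edist_set x (boundary K) <= c * e x].

Let U := ~` K `&` [set x | enorm (x - p) < 2 * r].

Let oU : open U.
Proof. by apply: openI; [exact: oK|exact: eball_open]. Qed.

Let r_2r : r < 2 * r. Proof. by rewrite ltr_pMl// ltr1n. Qed.

Let e_pos x : U x -> 0 < e x.
Proof.
by move=> [Kx xr]; have [KE _ _ _ _] := flat xr; rewrite ltNge; apply/negP => /KE.
Qed.

Let w (k M eps : R) (x : 'rV[R]_N) : R :=
  k * layer A P eps (c * e x) + - (M / r ^+ 2) * localizer p e x.

Let Cce : C2_on U (fun x => c * e x).
Proof. exact (C2_on_sub (@subsetT _ U) (C2_onZ openT c Ce)). Qed.

Let ce_dom (eps : R) : 0 < eps -> forall x, U x -> [set t | 0 < t + eps] (c * e x).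
Proof. by move=> e0 x /e_pos ex; rewrite /= addr_gt0// mulr_gt0. Qed.

Let Clayer (eps : R) : 0 < eps -> C2_on U (fun x => layer A P eps (c * e x)).
Proof.
move=> e0; exact (C2_on_comp oU Cce (ce_dom e0) (is_derive2_on_layer phi_cont dA dP (eps := eps))).
Qed.

Let Cloc : C2_on U (localizer p e).
Proof. exact (C2_on_sub (@subsetT _ U) (@C2_on_localizer R N p e Ce)). Qed.

(* The localizer only increases the Laplacian, so the layer term decides. *)
Let laplacian_w_ge k M eps x : 0 <= k -> 0 < M -> 0 < eps -> U x ->
  - (k * (c ^+ 2 * c + c * c) * phi (c * e x)) <= laplacian (w k M eps) x.
Proof.
move=> k0 M0 e0 Ux; have [Kx xr] := Ux; have ex := e_pos Ux.
have [_ g1 /andP[l1 l2] ce1 _] := flat xr.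
have ce0 : 0 < c * e x by rewrite mulr_gt0.
have CkL := C2_onZ oU k (Clayer e0).
have CmL := C2_onZ oU (- (M / r ^+ 2)) Cloc.
rewrite /w (laplacianD oU CkL CmL Ux) (laplacianZ oU _ (Clayer e0) Ux).
rewrite (laplacianZ oU _ Cloc Ux) laplacian_localizer//.
rewrite (laplacian_comp oU Cce (ce_dom e0) (is_derive2_on_layer phi_cont dA dP (eps := eps)) Ux).
rewrite (gradsqZ c Ce)// (laplacianZ openT c Ce)//.
have te : 0 <= c * e x <= 1 by rewrite ltW.
have /andP[l0 lp] := layer'_bounds phi_pos phi_noninc dA e0 te.
have pe : phi (c * e x + eps) <= phi (c * e x) by apply: phi_noninc => //; rewrite lerDl ltW.
have pp : 0 <= phi (c * e x + eps) by rewrite ltW// phi_pos// addr_gt0.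
have Mr : 0 <= M / r ^+ 2 by rewrite divr_ge0 ?exprn_ge0// ltW.
have gp : 0 <= gradsq e x by apply: sumr_ge0 => i _; exact: sqr_ge0.
have loc : 0 <= - (M / r ^+ 2) * (2 * N%:R * (1 + laplacian e x)).
  have l10 : 0 <= - (1 + laplacian e x) by rewrite opprD addrC subr_ge0.
  by rewrite mulNr -!mulrN; apply: mulr_ge0 => //; exact: mulr_ge0.
have main : - ((c ^+ 2 * c + c * c) * phi (c * e x)) <=
    layer'' phi eps (c * e x) * (c ^+ 2 * gradsq e x) +
    layer' A eps (c * e x) * (c * laplacian e x).
  rewrite mulrDl opprD /layer''; apply: lerD.
    rewrite mulNr lerN2 [leRHS]mulrC; apply: ler_pM => //.
      by rewrite mulr_ge0// sqr_ge0.
    by rewrite ler_wpM2l// sqr_ge0.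
  rewrite lerNl -!mulrN [leRHS]mulrC; apply: ler_pM => //.
  - by rewrite mulr_ge0 ?(ltW c0)// (le_trans _ l1).
  - exact: le_trans lp pe.
  - by rewrite ler_wpM2l// ltW.
rewrite -[leLHS]addr0; apply: lerD; last exact: loc.
by rewrite -mulrA -mulrN; exact: ler_wpM2l.
Qed.

Lemma solution_ge_layer_barrier (M k eps : R) : 0 < M -> 0 <= k -> 0 < eps ->
  k * layer A P eps 1 <= M -> k * (c ^+ 2 * c + c * c) <= f M ->
  forall th x, 0 < th -> ~ K x -> enorm (x - p) <= r -> w k M eps x - th <= u x.
Proof.
move=> M0 k0 e0 kM kf th x th0 Kx xr.
have Ux : U x by split => //; exact: le_lt_trans r_2r.
have ex := e_pos Ux.
have kp : 0 < k * phi eps * c + 1.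
  by rewrite ltr_wpDl// !mulr_ge0// ltW// phi_pos.
(* Below the height [h] the barrier is smaller than the tolerance [th]. *)
pose h := Num.min (e x) (th / (k * phi eps * c + 1)).
have h0 : 0 < h by rewrite lt_min ex divr_gt0.
have [hx hth] : h <= e x /\ h <= th / (k * phi eps * c + 1).
  by rewrite !ge_min !lexx orbT.
pose B := [set y | enorm (y - p) <= r] `&` [set y | h <= e y].
have BU : B `<=` U.
  move=> y [/= yr hy]; have yr2 := le_lt_trans yr r_2r; split => //.
  by have [KE _ _ _ _] := flat yr2; move=> /KE; rewrite leNgt (lt_le_trans h0 hy).
have ce : continuous e by move=> y; have [] := Ce (Logic.I : setT y).
have cB : compact B.
  apply: compact_closedI; first exact: eball_compact.
  have := @preimage_closed 'rV[R]_N R e [set t : R | h <= t].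
  by apply; [move=> y _; exact: ce|exact: closed_ge].
have Cw : C2_on U (w k M eps).
  exact (C2_onD oU (C2_onZ oU k (Clayer e0)) (C2_onZ oU (- (M / r ^+ 2)) Cloc)).
have UK : U `<=` ~` K by move=> y [].
have CuU : C2_on U u by exact (C2_on_sub UK Cu).
have bK : boundary K !=set0 by exists p.
suff H y : B y -> u y < w k M eps y - th ->
    nbhs y B /\ laplacian u y < laplacian (w k M eps) y.
  by apply: (comparison_principle oU BU cB CuU Cw H); split.
move=> By uw; have Uy := BU _ By; have [yr hy] := By; have [Ky yr2] := Uy.
have uy := upos Ky; have ey := e_pos Uy.
have [_ _ _ ce1 dist] := flat yr2.
have cey : 0 <= c * e y by rewrite mulr_ge0// ltW.
have loc0 : 0 <= M / r ^+ 2 * localizer p e y.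
  rewrite mulr_ge0 ?divr_ge0 ?exprn_ge0// ?(ltW M0) ?(ltW r0)//.
  by apply: le_trans (localizer_ge p (ltW ey)); exact: sqr_ge0.
have lay1 : k * layer A P eps (c * e y) <= M.
  apply: le_trans kM; rewrite ler_wpM2l//.
  exact: layer_nondecr phi_cont phi_pos phi_noninc dA dP _ _ _ e0 cey ce1 (lexx _).
have wM : w k M eps y <= M by rewrite /w mulNr; lra.
split.
- have yr' : enorm (y - p) < r.
    rewrite lt_neqAle yr andbT; apply/eqP => E.
    have : M <= M / r ^+ 2 * localizer p e y.
      rewrite mulrAC ler_pdivlMr ?exprn_gt0// ler_pM2l//.
      by have := localizer_ge p (ltW ey); rewrite E.
    by move: uw; rewrite /w mulNr; lra.
  have hy' : h < e y.
    rewrite lt_neqAle hy andbT; apply/eqP => E.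
    have le0 : 0 <= c * e y := cey.
    have pk : phi (0 + eps) <= phi eps by rewrite add0r.
    have := layer_increment phi_cont phi_pos phi_noninc dA dP e0 (lexx _) le0 ce1 pk.
    rewrite layer0 !subr0 => lay.
    have : k * layer A P eps (c * e y) <= th.
      apply: (le_trans (ler_wpM2l k0 lay)); move: hth; rewrite E ler_pdivlMr//.
      rewrite mulrDr mulr1 => hth; apply: le_trans hth.
      have -> : k * (phi eps * (c * e y)) = e y * (k * phi eps * c) by ring.
      by rewrite lerDl ltW.
    by move: uw; rewrite /w mulNr; lra.
  have c1 : \forall v \near y, enorm (v - p) < r.
    by exact: cvgr_lt (@enormB_continuous R N p y) _ yr'.
  have c2 : \forall v \near y, h < e v by exact: cvgr_gt (ce y) _ hy'.
  by apply: filterS2 c1 c2 => v v1 v2; split; exact: ltW.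
- have uM : u y < M by lra.
  have := solution_laplacian_lt bK Ky uM (dist Ky) kf.
  move=> /lt_le_trans; apply; exact: laplacian_w_ge.
Qed.

(** The same argument near [p], with [eps] tending to [0] instead of [r1] to
    infinity: the increment of [layer] between [c * e q] and [1] stays bounded
    while [S = layer eps 1] tends to infinity. *)
Lemma moment_bounded_below : exists m : R, forall t : R, 0 < t -> m <= moment A P t.
Proof.
apply: contrapT => unb.
have {}unb (m : R) : exists2 t : R, 0 < t & moment A P t < m.
  apply: contrapT => nm; apply: unb; exists m => t t0; rewrite leNgt; apply/negP => mt.
  by apply: nm; exists t.
have [q [Kq qr qloc]] : exists q, [/\ ~ K q, enorm (q - p) < r &
    localizer p e q <= r ^+ 2 / 4].
  have r24 : 0 < r ^+ 2 / 4 by rewrite divr_gt0// exprn_gt0.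
  apply: contrapT => nq; have [_ iKp] := bp; apply: iKp.
  apply: filterS2 (eball_nbhs p r0) (localizer_small Ce ep r24) => y y1 y2.
  by apply: contrapT => Ky; apply: nq; exists y.
have Uq : U q by split => //; exact: lt_trans r_2r.
have eq := e_pos Uq; have uq := upos Kq.
have [_ _ _ ce1 _] := flat (lt_trans qr r_2r).
have ceq : 0 < c * e q by rewrite mulr_gt0.
pose M := 2 * u q + 4.
have M0 : 0 < M by rewrite /M; lra.
have fM := fpos M0.
have cc : 0 < c ^+ 2 * c + c * c by rewrite addr_gt0 ?mulr_gt0.
have McfM : 0 < M * (c ^+ 2 * c + c * c) / f M by rewrite divr_gt0// mulr_gt0.
have ph : 0 < phi (c * e q) by exact: phi_pos.
pose T1 := 1 + 4 * phi (c * e q) + M * (c ^+ 2 * c + c * c) / f M.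
have T1pos : 0 < T1 by rewrite /T1; lra.
have [t t0 tm] := unb (moment A P 1 - 2 * T1).
have t1 : t < 1.
  rewrite ltNge; apply/negP => t1.
  by have := moment_nondecr phi_pos dA dP ltr01 t1; lra.
pose eps := t / 2.
have e0 : 0 < eps by rewrite divr_gt0.
have e2 : 2 * eps = t by rewrite /eps; field.
have e21 : 2 * eps <= 1 by rewrite e2 ltW.
pose S := layer A P eps 1.
have ST : T1 <= S.
  have := layer1_ge_moment phi_pos dA dP e0 e21; rewrite e2 -/S; lra.
have S0 : 0 < S := lt_le_trans T1pos ST.
have MS : 0 <= M / S by rewrite divr_ge0// ltW.
have MSM : M / S * layer A P eps 1 <= M by rewrite -/S divfK// gt_eqF.
have MSf : M / S * (c ^+ 2 * c + c * c) <= f M.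
  rewrite mulrAC ler_pdivrMr// [leRHS]mulrC -ler_pdivrMr//.
  by apply: le_trans ST; rewrite /T1; lra.
have := solution_ge_layer_barrier M0 MS e0 MSM MSf ltr01 Kq (ltW qr).
rewrite /w mulNr.
have loc : M / r ^+ 2 * localizer p e q <= M / 4.
  rewrite -mulrA ler_pM2l// mulrC ler_pdivrMr ?exprn_gt0//.
  by rewrite mulrC.
have pk : phi (c * e q + eps) <= phi (c * e q) by apply: phi_noninc => //; rewrite lerDl ltW.
have := layer_increment phi_cont phi_pos phi_noninc dA dP e0 (ltW ceq) ce1 (lexx _) pk.
rewrite -/S => inc.
have lay : S - phi (c * e q) <= layer A P eps (c * e q).
  have : phi (c * e q) * (1 - c * e q) <= phi (c * e q).
    by rewrite ler_piMr ?(ltW ph)// lerBlDr lerDl ltW.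
  lra.
have lay2 : M / S * phi (c * e q) <= M / 4.
  have X4 : 4 * phi (c * e q) <= S by apply: le_trans ST; rewrite /T1; lra.
  by rewrite -mulrA ler_pM2l// mulrC ler_pdivrMr//; lra.
have := ler_wpM2l MS lay; rewrite mulrBr divfK ?gt_eqF// => lay3.
by move: lay3 lay2 loc; rewrite /M; lra.
Qed.

End AtBoundary.

End Necessity.

(** * Existence *)

Lemma is_derive_pospartX (R : realType) (n : nat) (t : R) :
  is_derive t (1 : R) (fun s : R => Num.max 0 s ^+ n.+2) (n.+2%:R * Num.max 0 t ^+ n.+1).
Proof.
have dX (s : R) : is_derive s (1 : R) (fun s : R => s ^+ n.+2) (n.+2%:R * s ^+ n.+1).
  by split; [exact: exprn_derivable|rewrite exp_derive /GRing.scale /= mulr1].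
case: (ltgtP t 0) => [t0|t0|->].
- rewrite expr0n mulr0.
  apply: near_eq_is_derive (is_derive_cst (0 : R) t 1).
  have : \forall s \near t, s < 0 by exact: lt_nbhsl.
  by apply: filterS => s s0; rewrite max_l ?expr0n// ltW.
- apply: near_eq_is_derive (dX t).
  have : \forall s \near t, 0 < s by exact: lt_nbhsr.
  by apply: filterS => s s0; rewrite max_r// ltW.
- rewrite expr0n mulr0.
  have main : h^-1 *: (Num.max 0 h ^+ n.+2 : R) @[h --> (0 : R)^'] --> (0 : R).
    apply/cvgr0Pnorm_lt => e e0.
    have : \forall h \near (0 : R)^', `|h| < Num.min e 1.
      by apply: dnbhs0_lt; rewrite lt_min e0 ltr01.
    apply: filterS => h; rewrite lt_min => /andP[he h1].
    have [h0|h0] := leP h 0.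
      by rewrite expr0n scaler0 normr0.
    rewrite exprS [_ *: _]mulrA mulVf ?gt_eqF// mul1r.
    rewrite normrX; apply: le_lt_trans he.
    by rewrite exprS ler_piMr// exprn_ile1 ?normr_ge0// ltW.
  have E : (fun h : R => h^-1 *: (Num.max 0 (h *: (1 : R) + 0) ^+ n.+2 -
      Num.max 0 (0 : R) ^+ n.+2)) = (fun h => h^-1 *: (Num.max 0 h ^+ n.+2 : R)).
    by apply/funext => h; rewrite maxxx expr0n subr0 addr0 [_ *: 1]mulr1.
  split; first by apply/cvg_ex; exists 0; rewrite /= E; exact: main.
  by rewrite /derive /= E; exact: cvg_lim main.
Qed.

(** Composition with a concave increasing function preserves superharmonicity; as
    [cap] is constant above [1], it extends a local supersolution that exceeds [1]
    away from a point to the whole complement of [K]. *)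
Definition cap (R : realType) (t : R) : R := 1 - Num.max 0 (1 - t) ^+ 3.
Definition cap' (R : realType) (t : R) : R := 3 * Num.max 0 (1 - t) ^+ 2.
Definition cap'' (R : realType) (t : R) : R := - (6 * Num.max 0 (1 - t)).

Lemma is_derive2_on_cap (R : realType) (I : set R) :
  is_derive2_on I (@cap R) (@cap' R) (@cap'' R).
Proof.
move=> t _.
have d1 : is_derive t (1 : R) (fun s : R => 1 - s) (-1).
  by apply: is_derive_eq; ring.
have dm n := @is_derive1_comp R _ (fun s => 1 - s) t _ _ (is_derive_pospartX n (1 - t)) d1.
split.
- have := is_deriveB (is_derive_cst (1 : R) t 1) (dm 1%N).
  by move=> D; apply: (is_derive_eq D); rewrite /cap'; ring.
- have := is_deriveZ 3 (dm 0%N).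
  by move=> D; apply: (is_derive_eq D); rewrite /cap'' /GRing.scale /= expr1; ring.
- have -> : @cap'' R = fun s => - (6 * Num.max 0 (1 - s)) by [].
  apply: continuousN; apply: continuousM; first exact: cst_continuous.
  have c1 : {for t, continuous (fun s : R => 1 - s)}.
    by apply: continuousB; [exact: cst_continuous|exact: cvg_id].
  apply: (@continuous_comp _ _ _ (fun s : R => 1 - s) (fun s => Num.max 0 s) t c1).
  have -> : (fun s : R => Num.max 0 s) = (fun s => (s + `|s|) / 2).
    apply/funext => s; have [s0|s0] := leP s 0.
      by rewrite ler0_norm// subrr mul0r.
    by rewrite gtr0_norm//; field.
  apply: continuousM; last exact: cst_continuous.
  by apply: continuousD; [exact: cvg_id|exact: norm_continuous].
Qed.

Lemma cap_ge1 (R : realType) (t : R) : 1 <= t -> cap t = 1.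
Proof. by move=> t1; rewrite /cap max_l ?subr_le0// expr0n subr0. Qed.

Lemma cap_ge0 (R : realType) (t : R) : 0 <= t -> 0 <= cap t.
Proof.
move=> t0; rewrite subr_ge0 exprn_ile1 ?le_max ?lexx// ge_max ler01.
by rewrite lerBlDr lerDl.
Qed.

Lemma cap'_ge0 (R : realType) (t : R) : 0 <= cap' t.
Proof. by rewrite mulr_ge0// sqr_ge0. Qed.

Lemma cap'_half (R : realType) (t : R) : t <= 2^-1 -> 3 / 4 <= cap' t.
Proof.
move=> t2; rewrite /cap' max_r; last lra.
have : 4^-1 <= (1 - t) ^+ 2 by nra.
lra.
Qed.

Lemma cap''_le0 (R : realType) (t : R) : cap'' t <= 0.
Proof. by rewrite oppr_le0 mulr_ge0// le_max lexx. Qed.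

(** Requiring superharmonicity on the whole complement, not only near [p], is what
    allows to add up local supersolutions at different points. *)
Definition local_supersolution (R : realType) (n : nat) (K : set 'rV[R]_n)
    (phi : R -> R) (p : 'rV[R]_n) (V : 'rV[R]_n -> R) : Prop :=
  [/\ C2_on (~` K) V, forall x, ~ K x -> 0 <= V x,
      forall x, ~ K x -> laplacian V x <= 0 &
      \forall x \near p, ~ K x -> phi (edist_set x (boundary K)) <= - laplacian V x].

Section Existence.
Variables (R : realType) (N : nat) (K : set 'rV[R]_N) (phi A P : R -> R).
Hypothesis hN : (3 <= N)%N.
Hypothesis cK : closed K.
Hypothesis phi_cont : forall t : R, 0 < t -> {for t, continuous phi}.
Hypothesis phi_pos : forall t : R, 0 < t -> 0 < phi t.
Hypothesis phi_noninc : forall s t : R, 0 < s -> s <= t -> phi t <= phi s.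
Hypothesis dA : forall t : R, 0 < t -> is_derive t (1 : R) A (phi t).
Hypothesis dP : forall t : R, 0 < t -> is_derive t (1 : R) P (A t).
Variable (Mm : R).
Hypothesis moment_var : forall a b : R, 0 < a -> a < b -> moment A P b - moment A P a <= Mm.

Let oK : open (~` K) := closed_openC cK.

Let edist_gt0 x : boundary K !=set0 -> ~ K x -> 0 < edist_set x (boundary K).
Proof.
move=> bK Kx; apply: edist_set_gt0 => //; first exact: closed_boundary.
by move=> /(boundary_sub cK).
Qed.

(** Near an isolated point the distance to the boundary is the distance to it. *)
Lemma isolated_supersolution p : boundary K p -> (\forall x \near p, K x -> x = p) ->
  exists V, local_supersolution K phi p V.
Proof.
move=> bp iso; have Kp := boundary_sub cK bp.
have [F [F' [F'' [dF F0 FL]]]] := newton_profile phi_cont phi_pos dA dP moment_var.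
have neqp y : (~` K) y -> y != p by move=> Ky; apply/eqP => yp; apply: Ky; rewrite yp.
have lapV x : ~ K x -> phi (enorm (x - p)) <= - laplacian (fun x => F (enorm (x - p))) x.
  move=> /neqp xp; rewrite (laplacian_radial dF xp).
  by apply: FL => //; exact: enorm_gt0.
exists (fun x => F (enorm (x - p))); split.
- have sub : ~` K `<=` ~` [set p] by move=> y /neqp /eqP.
  exact (C2_on_sub sub (C2_on_radial dF)).
- by move=> x /neqp xp; apply: F0; exact: enorm_gt0.
- move=> x Kx; rewrite -oppr_ge0; apply: le_trans (lapV x Kx).
  by rewrite ltW// phi_pos// enorm_gt0// neqp.
- have [r r0 rP] := nbhs_eball iso.
  have r20 : 0 < r / 2 by rewrite divr_gt0.
  apply: filterS (eball_nbhs p r20) => x xr Kx.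
  apply: le_trans (lapV x Kx); apply: phi_noninc; first by rewrite enorm_gt0// neqp.
  apply: edist_set_ge; first by exists p.
  move=> y /(boundary_sub cK) Ky; have [yr|yr] := ltP (enorm (y - p)) r.
    by rewrite (rP y yr Ky).
  have := enormB_triangle x y p; rewrite [enorm (y - x)]enormBC.
  have aux (a b c : R) : r <= c -> a < r / 2 -> c <= b + a -> a <= b by lra.
  exact: aux.
Qed.

Lemma layer0_bounded : exists k I1 : R, 0 < I1 /\
  forall t : R, 0 < t -> t <= 1 -> 0 <= layer A P 0 t + k <= I1.
Proof.
have M0 : 0 <= Mm.
  have := @moment_var 1 2 ltr01; rewrite ltr1n => /(_ isT); apply: le_trans.
  by rewrite subr_ge0 (moment_nondecr phi_pos dA dP)// ler1n.
exists (- P 0 - moment A P 1 + Mm), (Mm + 1); split; first by rewrite ltr_wpDl.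
move=> t t0 t1; rewrite /layer !addr0.
have -> : t * A 1 - P t + P 0 + (- P 0 - moment A P 1 + Mm) =
    t * A 1 - P t - moment A P 1 + Mm by ring.
have lo : moment A P 1 - Mm <= moment A P t.
  have [t1'|t1'] := ltP t 1; first by have := moment_var t0 t1'; lra.
  have -> : t = 1 by apply/eqP; rewrite eq_le t1 t1'.
  by rewrite lerBlDr lerDl.
have A1 := primitive_ge0 phi_pos phi_noninc dA t0 t1.
have tA : 0 <= t * (A 1 - A t) by rewrite mulr_ge0// ltW.
have up : t * A 1 - P t <= A 1 - P 1.
  have dL (s : R) : t <= s <= 1 -> is_derive s (1 : R) (fun s => s * A 1 - P s) (A 1 - A s).
    move=> /andP[ts _]; have d := dP (lt_le_trans t0 ts).
    by apply: is_derive_eq; rewrite /GRing.scale /=; ring.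
  have pL (s : R) : t <= s <= 1 -> 0 <= A 1 - A s.
    by move=> /andP[ts s1]; apply: (primitive_ge0 phi_pos phi_noninc dA) => //; exact: lt_le_trans ts.
  by have := ge0_is_derive_le t1 dL pL; rewrite mul1r.
move: lo tA up; rewrite /moment => lo tA up; apply/andP; split; lra.
Qed.

(** The function [layer 0] of [e / c] is a bounded local supersolution. Adding a
    multiple of the localizer makes it exceed [1] at a distance from [p], but not
    close to [p], so [cap] turns it into a supersolution on the complement
    of [K]. *)
Lemma flattened_supersolution p e c : boundary K p -> 0 < c -> flattens K p e c ->
  exists V, local_supersolution K phi p V.
Proof.
move=> bp c0 [Ce ep flat].
have bK : boundary K !=set0 by exists p.
have ce : {for p, continuous e} by have [] := Ce p Logic.I.
have ec : e p < c by rewrite ep.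
have [r r0 rP] : exists2 r, 0 < r & forall x, enorm (x - p) < r ->
    [/\ K x <-> e x <= 0, 4^-1 <= gradsq e x, laplacian e x <= -1, e x <= c &
        ~ K x -> e x <= c * edist_set x (boundary K)].
  apply: nbhs_eball; apply: filterS2 flat (near_le_bound ce ec).
  move=> x [KE /andP[g1 _] /andP[l1 _] dist] exc; split => //.
    by rewrite -lerN2 opprK.
  by move=> /dist[].
have [k [I1 [I1_gt0 kI]]] := layer0_bounded.
pose U := ~` K `&` [set x | enorm (x - p) < r].
have oU : open U by apply: openI => //; exact: eball_open.
have e_pos x : U x -> 0 < e x.
  by move=> [Kx xr]; have [KE _ _ _ _] := rP x xr; rewrite ltNge; apply/negP => /KE.
pose s (x : 'rV[R]_N) : R := c^-1 * e x.
have Cs : C2_on U s by exact (C2_on_sub (@subsetT _ U) (C2_onZ openT c^-1 Ce)).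
have s_pos x : U x -> [set t : R | 0 < t] (s x).
  by move=> Ux; rewrite /= mulr_gt0 ?invr_gt0 ?e_pos.
have dl := is_derive2_on_layer0 phi_cont dA dP.
pose g x := layer A P 0 (s x).
have Cg : C2_on U g by exact (C2_on_comp oU Cs s_pos dl).
pose a1 := (4 * I1)^-1.
pose a2 := 4 / r ^+ 2.
have a1_gt0 : 0 < a1 by rewrite invr_gt0 mulr_gt0.
have a2_gt0 : 0 < a2 by rewrite divr_gt0 ?exprn_gt0.
pose w x := a1 * (g x + k) + a2 * localizer p e x.
have Cgk : C2_on U (fun x => g x + k) by exact (C2_onD oU Cg (C2_on_cst oU k)).
have Cl : C2_on U (localizer p e).
  exact (C2_on_sub (@subsetT _ U) (@C2_on_localizer R N p e Ce)).
have C1 := C2_onZ oU a1 Cgk; have C2 := C2_onZ oU a2 Cl.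
have Cw : C2_on U w by exact (C2_onD oU C1 C2).
have gb x : U x -> 0 <= g x + k <= I1.
  move=> Ux; apply: kI; first exact: s_pos.
  have [_ _ _ exc _] := rP x (proj2 Ux).
  by rewrite /s mulrC ler_pdivrMr// mul1r.
have loc_ge x : U x -> enorm (x - p) ^+ 2 <= localizer p e x.
  by move=> /e_pos/ltW; exact: localizer_ge.
have w_ge0 x : U x -> 0 <= w x.
  move=> Ux; have /andP[g0 _] := gb x Ux.
  apply: addr_ge0; first by rewrite mulr_ge0// ltW.
  apply: mulr_ge0; first exact: ltW.
  exact: le_trans (sqr_ge0 _) (loc_ge x Ux).
have w_ge1 x : U x -> r / 2 <= enorm (x - p) -> 1 <= w x.
  move=> Ux xr; have /andP[g0 _] := gb x Ux.
  rewrite -[leLHS]add0r lerD ?mulr_ge0 ?(ltW a1_gt0)//.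
  have -> : 1 = a2 * (r / 2) ^+ 2 by rewrite /a2; field; rewrite gt_eqF.
  rewrite ler_wpM2l ?(ltW a2_gt0)//; apply: le_trans (loc_ge x Ux).
  by rewrite lerXn2r ?nnegrE ?enorm_ge0// divr_ge0// ltW.
have lapw x : U x -> laplacian w x <= - (a1 / (4 * c ^+ 2) * phi (edist_set x (boundary K))).
  move=> Ux; have [Kx xr] := Ux; have [_ g4 l1 exc dist] := rP x xr.
  have sx := s_pos x Ux.
  rewrite (laplacianD oU C1 C2 Ux) (laplacianZ oU a1 Cgk Ux) (laplacianZ oU a2 Cl Ux).
  rewrite (laplacianD oU Cg (C2_on_cst oU k) Ux) laplacian_cst addr0.
  rewrite (laplacian_localizer p x Ce).
  rewrite (laplacian_comp oU Cs s_pos dl Ux) (gradsqZ c^-1 Ce)// (laplacianZ openT c^-1 Ce)//.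
  have l2 : a2 * (2 * N%:R * (1 + laplacian e x)) <= 0.
    by rewrite pmulr_rle0// mulr_ge0_le0 ?mulr_ge0// addrC -lerBrDr sub0r.
  have s1 : s x <= 1 by rewrite /s mulrC ler_pdivrMr// mul1r.
  have l3 : layer' A 0 (s x) * (c^-1 * laplacian e x) <= 0.
    rewrite mulr_ge0_le0//.
      by rewrite /layer' !addr0; exact: primitive_ge0 phi_pos phi_noninc dA _ _ sx s1.
    by rewrite mulr_ge0_le0 ?invr_ge0 ?(ltW c0)// (le_trans l1)// oppr_le0.
  have sd : s x <= edist_set x (boundary K) by rewrite /s mulrC ler_pdivrMr// mulrC dist.
  have ps : phi (edist_set x (boundary K)) <= phi (s x) by exact: phi_noninc.
  have l4 : layer'' phi 0 (s x) * (c^-1 ^+ 2 * gradsq e x) <=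
      - ((4 * c ^+ 2)^-1 * phi (edist_set x (boundary K))).
    rewrite /layer'' addr0 mulNr lerN2 [leRHS]mulrC; apply: ler_pM => //.
    - by rewrite invr_ge0 mulr_ge0// sqr_ge0.
    - by rewrite ltW// phi_pos// edist_gt0.
    - by rewrite invfM exprVn mulrC ler_wpM2l// invr_ge0 sqr_ge0.
  rewrite -[leRHS]addr0; apply: lerD; last exact: l2.
  rewrite -mulrA -mulrN; apply: ler_wpM2l; first exact: ltW.
  by rewrite -[leRHS]addr0; apply: lerD; [exact: l4|exact: l3].
pose lam := 64 * I1 * c ^+ 2.
have lam_gt0 : 0 < lam by rewrite !mulr_gt0// exprn_gt0.
have dcap := @is_derive2_on_cap R setT.
have inT x : U x -> [set: R] (w x) by [].
pose V1 x := lam * cap (w x).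
have Ccap : C2_on U (fun x => cap (w x)) by exact (C2_on_comp oU Cw inT dcap).
have CV1 : C2_on U V1 by exact (C2_onZ oU lam Ccap).
have lapV1 x : U x -> laplacian V1 x <= lam * (cap' (w x) * laplacian w x).
  move=> Ux; rewrite (laplacianZ oU lam Ccap Ux) (laplacian_comp oU Cw inT dcap Ux).
  rewrite ler_wpM2l ?(ltW lam_gt0)// gerDr mulr_le0_ge0 ?cap''_le0//.
  by apply: sumr_ge0 => i _; exact: sqr_ge0.
have lapw0 x : U x -> laplacian w x <= 0.
  move=> Ux; apply: (le_trans (lapw x Ux)); rewrite oppr_le0 mulr_ge0//.
    by rewrite divr_ge0 ?(ltW a1_gt0)// mulr_ge0// sqr_ge0.
  by rewrite ltW// phi_pos// edist_gt0//; case: Ux.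
pose V x := if enorm (x - p) < r then V1 x else lam.
have nearK x : ~ K x -> \forall y \near x, ~ K y.
  by move=> Kx; apply: open_nbhs_nbhs; split.
(* Two overlapping descriptions: [V = V1] inside the ball of radius [r], and
   [V = lam] outside the ball of radius [r / 2]. *)
have near_in x : U x -> \forall y \near x, V1 y = V y.
  move=> [_ xr]; have : \forall y \near x, enorm (y - p) < r.
    by apply: open_nbhs_nbhs; split => //; exact: eball_open.
  by apply: filterS => y yr; rewrite /V yr.
have r2r : r / 2 < r by rewrite ltr_pdivrMr// ltr_pMr// ltr1n.
have near_out x : ~ K x -> ~ U x -> \forall y \near x, (fun=> lam) y = V y.
  move=> Kx Ux; have xr : r / 2 < enorm (x - p).
    by rewrite (lt_le_trans r2r)// leNgt; apply/negP => xr; apply: Ux.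
  have c1 : \forall y \near x, r / 2 < enorm (y - p).
    by exact: cvgr_gt (@enormB_continuous R N p x) _ xr.
  apply: filterS2 c1 (nearK x Kx) => y y1 Ky; rewrite /V; case: ifP => // yr.
  by rewrite /V1 cap_ge1 ?mulr1// w_ge1// ltW.
exists V; split.
- move=> x Kx; have [Ux|Ux] := pselect (U x).
    have sub : [set x] `<=` U by move=> _ ->.
    exact: (C2_on_near_eq (near_in x Ux) (C2_on_sub sub CV1)).
  have sub : [set x] `<=` [set: 'rV[R]_N] by [].
  exact: (C2_on_near_eq (near_out x Kx Ux) (C2_on_sub sub (C2_on_cst openT lam))).
- move=> x Kx; rewrite /V; case: ifP => xr; last exact: ltW.
  by rewrite mulr_ge0 ?(ltW lam_gt0)// cap_ge0// w_ge0.
- move=> x Kx; have [Ux|Ux] := pselect (U x).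
    rewrite -(laplacian_near_eq (near_in x Ux)); apply: (le_trans (lapV1 x Ux)).
    by rewrite pmulr_rle0// mulr_ge0_le0 ?cap'_ge0// lapw0.
  by rewrite -(laplacian_near_eq (near_out x Kx Ux)) laplacian_cst.
have a2i : 0 < (4 * a2)^-1 by rewrite invr_gt0 mulr_gt0.
apply: filterS2 (eball_nbhs p r0) (localizer_small Ce ep a2i) => x xr xl Kx.
have Ux : U x by split.
rewrite -(laplacian_near_eq (near_in x Ux)) lerNr; apply: (le_trans (lapV1 x Ux)).
have w2 : w x <= 2^-1.
  have /andP[_ gI] := gb x Ux.
  have h1 : a1 * (g x + k) <= 4^-1.
    by rewrite /a1 mulrC ler_pdivrMr ?mulr_gt0//; lra.
  have h2 : a2 * localizer p e x <= 4^-1.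
    by rewrite mulrC -ler_pdivlMr// -invfM.
  by rewrite /w; lra.
have c34 := cap'_half w2.
have ph : 0 < phi (edist_set x (boundary K)) by rewrite phi_pos// edist_gt0.
have a1c : 0 <= a1 / (4 * c ^+ 2) by rewrite divr_ge0 ?(ltW a1_gt0)// mulr_ge0// sqr_ge0.
apply: (@le_trans _ _ (lam * (3 / 4 * - (a1 / (4 * c ^+ 2) * phi (edist_set x (boundary K)))))).
  rewrite ler_wpM2l ?(ltW lam_gt0)//.
  apply: (@le_trans _ _ (3 / 4 * laplacian w x)).
    by rewrite ler_wnM2r// lapw0.
  by rewrite ler_wpM2l// lapw.
rewrite mulrN mulrN lerN2 !mulrA ler_peMl ?(ltW ph)//.
rewrite /lam /a1 (_ : _ * _ = 3); first by rewrite ler1n.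
by field; rewrite !gt_eqF.
Qed.

Lemma local_supersolution_exists p : finite_C2_or_point_components K ->
  boundary K p -> exists V, local_supersolution K phi p V.
Proof.
move=> [fK comp] bp; have Kp := boundary_sub cK bp.
have near_comp := near_connected_component cK fK Kp.
have [|[D CD ccD]|[a ca]] := comp (connected_component K p).
- by exists p.
- have [e [c [c0 fl]]] := flattens_exists cK fK Kp (proj2 bp) ccD CD.
  exact: flattened_supersolution bp c0 fl.
- apply: isolated_supersolution => //; apply: filterS near_comp => x /[apply].
  have : connected_component K p p by exact: connected_component_refl.
  by rewrite ca => /= -> ->.
Qed.

End Existence.

Section GlobalSupersolution.
Variables (R : realType) (N : nat) (K : set 'rV[R]_N) (phi A P : R -> R).
Hypothesis hN : (3 <= N)%N.
Hypothesis cptK : compact K.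
Hypothesis compK : finite_C2_or_point_components K.
Hypothesis bK : boundary K !=set0.
Hypothesis phi_cont : forall t : R, 0 < t -> {for t, continuous phi}.
Hypothesis phi_pos : forall t : R, 0 < t -> 0 < phi t.
Hypothesis phi_noninc : forall s t : R, 0 < s -> s <= t -> phi t <= phi s.
Hypothesis dA : forall t : R, 0 < t -> is_derive t (1 : R) A (phi t).
Hypothesis dP : forall t : R, 0 < t -> is_derive t (1 : R) P (A t).
Variable (Mm : R).
Hypothesis moment_var : forall a b : R, 0 < a -> a < b -> moment A P b - moment A P a <= Mm.

Let cK : closed K.
Proof. exact: compact_closed (@norm_hausdorff _ _) cptK. Qed.

Let oK : open (~` K) := closed_openC cK.

Let cptbK : compact (boundary K).
Proof.
exact: (subclosed_compact (@closed_boundary _ K) cptK (boundary_sub cK)).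
Qed.

(** A finite cover of the boundary by balls where local supersolutions are
    effective also covers all points at a distance less than the smallest radius,
    since each supersolution works in the ball of twice the radius. *)
Lemma boundary_supersolution : exists (V : 'rV[R]_N -> R) (eps : R),
  [/\ 0 < eps, C2_on (~` K) V, forall x, ~ K x -> 0 <= V x,
      forall x, ~ K x -> laplacian V x <= 0 &
      forall x, ~ K x -> edist_set x (boundary K) < eps ->
        phi (edist_set x (boundary K)) <= - laplacian V x].
Proof.
have loc (p : 'rV[R]_N) : exists Vr : ('rV[R]_N -> R) * R,
    [/\ C2_on (~` K) Vr.1, forall x, ~ K x -> 0 <= Vr.1 x,
        forall x, ~ K x -> laplacian Vr.1 x <= 0, 0 < Vr.2 &
        boundary K p -> forall x, enorm (x - p) < 2 * Vr.2 -> ~ K x ->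
          phi (edist_set x (boundary K)) <= - laplacian Vr.1 x].
  have [bp|bp] := pselect (boundary K p); last first.
    exists (fun=> 0, 1); split => //; first exact (C2_on_cst oK 0).
    by move=> x _; rewrite laplacian_cst.
  have [V [CV V0 lV /nbhs_eball[r r0 rP]]] := local_supersolution_exists hN cK
    phi_cont phi_pos phi_noninc dA dP moment_var compK bp.
  exists (V, r / 2); split => //=; first by rewrite divr_gt0.
  by move=> _ x; rewrite mulrC divfK// => /rP.
have [Vr VrP] := choice loc.
move: cptbK; rewrite compact_cover => /(_ _ (boundary K)
  (fun p => [set x : 'rV[R]_N | enorm (x - p) < (Vr p).2])).
move=> [p _|p bp|D Dsub cov].
- exact: eball_open.
- by exists p => //=; rewrite subrr enorm0; have [] := VrP p.
pose s := finmap.enum_fset D.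
have [eps eps0 epsP] : exists2 eps : R, 0 < eps & forall p, p \in s -> eps <= (Vr p).2.
  elim: s => [|p l [eps eps0 IH]]; first by exists 1.
  have [_ _ _ r0 _] := VrP p.
  exists (Num.min eps (Vr p).2); first by rewrite lt_min eps0.
  move=> q; rewrite inE => /orP[/eqP ->|/IH]; first by rewrite ge_min lexx orbT.
  by move=> qe; rewrite ge_min qe.
have CVp p : C2_on (~` K) (Vr p).1 by have [] := VrP p.
exists (fun x => \sum_(p <- s) (Vr p).1 x), eps; split => //.
- exact (C2_on_sum oK s CVp).
- by move=> x Kx; apply: sumr_ge0 => p _; have [_ + _ _ _] := VrP p; apply.
- move=> x Kx; rewrite (laplacian_sum oK s CVp Kx).
  by apply: sumr_le0 => p _; have [_ _ + _ _] := VrP p; apply.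
move=> x Kx dx; have [y by_ xy] : exists2 y, boundary K y & enorm (x - y) < eps.
  apply: contrapT => no; move: dx; rewrite ltNge => /negP; apply.
  apply: edist_set_ge => // y by_; rewrite leNgt; apply/negP => xy.
  by apply: no; exists y.
have [p /= pD yp] := cov y by_.
have bp : boundary K p by have := Dsub _ pD; rewrite inE.
have [_ _ _ _ /(_ bp x)] := VrP p.
have xp : enorm (x - p) < 2 * (Vr p).2.
  have := enormB_triangle y x p; have := epsP p pD => e1 e2.
  have aux (a b1 c r e : R) : a <= b1 + c -> b1 < e -> e <= r -> c < r -> a < 2 * r by lra.
  exact: aux e2 xy e1 yp.
move=> /(_ xp Kx)/le_trans; apply; rewrite lerN2 (laplacian_sum oK s CVp Kx).
rewrite (bigD1_seq p)//=; last exact: finmap.fset_uniq.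
by rewrite gerDl sumr_le0// => q _; have [_ _ + _ _] := VrP q; apply.
Qed.

(** Far from [K] the distance to the boundary is at least half the distance to [z],
    which explains the dilation by [2]. *)
Lemma far_supersolution (z : 'rV[R]_N) : K z ->
  exists G : 'rV[R]_N -> R, [/\ C2_on (~` K) G, forall x, ~ K x -> 0 <= G x &
    forall x, ~ K x -> phi (2^-1 * enorm (x - z)) <= - laplacian G x].
Proof.
move=> Kz.
have [F [F' [F'' [dF F0 FL]]]] := newton_profile phi_cont phi_pos dA dP moment_var.
pose G (r : R) := 4 * F (2^-1 * r).
have half (s : R) : 0 < s -> 0 < 2^-1 * s by move=> r0; rewrite mulr_gt0.
have dG : is_derive2_on [set t | 0 < t] G (fun r => 2 * F' (2^-1 * r))
    (fun r => F'' (2^-1 * r)).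
  move=> r /= /half r0; have [d1 d2 c2] := dF _ r0.
  split.
  - have D := is_deriveZ 4 (is_derive_scale d1).
    by apply: (is_derive_eq D); rewrite /GRing.scale /=; field.
  - have D := is_deriveZ 2 (is_derive_scale d2).
    by apply: (is_derive_eq D); rewrite /GRing.scale /=; field.
  - exact: continuous_scale.
have neqz y : (~` K) y -> y != z by move=> Ky; apply/eqP => yz; apply: Ky; rewrite yz.
exists (fun x => G (enorm (x - z))); split.
- have sub : ~` K `<=` ~` [set z] by move=> y /neqz /eqP.
  exact (C2_on_sub sub (C2_on_radial dG)).
- by move=> x /neqz xz; rewrite mulr_ge0// F0// half// enorm_gt0.
- move=> x /neqz xz; rewrite (laplacian_radial dG xz).
  have r0 := enorm_gt0 xz; have FLx := FL N _ hN (half _ r0).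
  suff -> : 2 * F' (2^-1 * enorm (x - z)) * ((N%:R - 1) / enorm (x - z)) =
    F' (2^-1 * enorm (x - z)) * ((N%:R - 1) / (2^-1 * enorm (x - z))) by [].
  by field; rewrite gt_eqF.
Qed.

Lemma global_supersolution : exists V : 'rV[R]_N -> R,
  [/\ C2_on (~` K) V, forall x, ~ K x -> 0 <= V x &
      forall x, ~ K x -> phi (edist_set x (boundary K)) <= - laplacian V x].
Proof.
have [V1 [eps [eps0 C1 V1_ge0 lap1 V1P]]] := boundary_supersolution.
have [z bz] := bK; have Kz := boundary_sub cK bz.
have [G [CG G_ge0 GP]] := far_supersolution Kz.
have [r r0 Kr] := compact_in_eball z cptK.
have neqz y : ~ K y -> y != z by move=> Ky; apply/eqP => yz; apply: Ky; rewrite yz.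
pose lam := 1 + phi eps / phi r.
have q0 : 0 <= phi eps / phi r by rewrite divr_ge0// ltW// phi_pos.
have lam1 : 1 <= lam by rewrite /lam lerDl.
have lam0 : 0 <= lam by rewrite (le_trans ler01).
have ClG := C2_onZ oK lam CG.
exists (fun x => V1 x + lam * G x); split.
- exact (C2_onD oK C1 ClG).
- by move=> x Kx; rewrite addr_ge0 ?V1_ge0// mulr_ge0// G_ge0.
move=> x Kx; rewrite (laplacianD oK C1 ClG Kx) (laplacianZ oK lam CG Kx).
have xz := enorm_gt0 (neqz x Kx).
have h0 : 0 < 2^-1 * enorm (x - z) by rewrite mulr_gt0.
have ph := phi_pos h0; have GPx := GP x Kx.
rewrite opprD -mulrN.
have [near_bd|far] := ltP (edist_set x (boundary K)) eps.
  apply: (le_trans (V1P x Kx near_bd)); rewrite lerDl mulr_ge0//.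
  by rewrite (le_trans _ GPx)// ltW.
apply: (@le_trans _ _ (lam * phi (2^-1 * enorm (x - z)))); last first.
  rewrite -[leLHS]add0r lerD ?ler_wpM2l// oppr_ge0; exact: lap1.
have [xr|xr] := leP (2 * r) (enorm (x - z)).
  apply: (@le_trans _ _ (phi (2^-1 * enorm (x - z)))); last by rewrite ler_peMl// ltW.
  apply: phi_noninc => //; apply: edist_set_ge => // y /(boundary_sub cK) /Kr yr.
  have := enormB_triangle y x z.
  have aux (a b1 c : R) : 2 * r <= a -> c < r -> a <= b1 + c -> 2^-1 * a <= b1 by lra.
  exact: aux.
apply: (@le_trans _ _ (phi eps)); first exact: phi_noninc.
apply: (@le_trans _ _ (lam * phi r)).
  rewrite /lam mulrDl mul1r divfK ?gt_eqF ?phi_pos// lerDr ltW//.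
  exact: phi_pos.
rewrite ler_wpM2l//; apply: phi_noninc => //.
by rewrite ler_pdivrMl// ltW.
Qed.

End GlobalSupersolution.

(** * The equivalence *)

Lemma locally_holder_continuous (R : realType) (gam : R) (phi : R -> R) :
  0 < gam -> locally_holder_pos gam phi ->
  forall t : R, 0 < t -> {for t, continuous phi}.
Proof.
move=> gam0 hol t t0.
have t2 : 0 < t / 2 by rewrite divr_gt0.
have t22 : t / 2 <= 2 * t by lra.
have [C CP] := hol (t / 2) (2 * t) t2 t22.
apply/cvgrPdist_lt => e e0.
pose D := `|C| + 1.
have D0 : 0 < D by rewrite ltr_wpDl.
pose d := (e / D) `^ gam^-1.
have d0 : 0 < d by rewrite powR_gt0// divr_gt0.
have dg : d `^ gam = e / D.
  by rewrite /d -powRrM mulVf ?gt_eqF// powRr1// divr_ge0// ltW.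
have n1 : \forall s \near t, `|t - s| < d.
  by have := nbhsx_ballx t d d0; rewrite -ball_normE.
have n2 : \forall s \near t, t / 2 < s by apply: lt_nbhsr; lra.
have n3 : \forall s \near t, s < 2 * t by apply: lt_nbhsl; lra.
apply: filterS3 n1 n2 n3 => s s1 s2 s3.
have h1 : t / 2 <= t <= 2 * t by apply/andP; split; lra.
have h2 : t / 2 <= s <= 2 * t by apply/andP; split; exact: ltW.
apply: (le_lt_trans (CP _ _ h1 h2)).
apply: (@le_lt_trans _ _ (`|C| * (e / D))).
  apply: (@le_trans _ _ (`|C| * `|t - s| `^ gam)).
    by rewrite ler_wpM2r ?powR_ge0// ler_norm.
  rewrite ler_wpM2l// -dg ge0_ler_powR ?nnegrE ?normr_ge0 ?(ltW gam0) ?(ltW d0)//.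
  exact: ltW.
by rewrite mulrA ltr_pdivrMr// mulrC ltr_pM2l// /D ltrDl.
Qed.

Theorem theorem1p1 (R : realType) (N : nat) (hN : (3 <= N)%N)
  (K : set 'rV[R]_N)
  (hKcompact : compact K)
  (hKcomponents : finite_C2_or_point_components K)
  (hK1 : K1_part K !=set0)
  (f : R -> R)
  (hfC1 : C1_pos f)
  (hfpos : forall t : R, 0 < t -> 0 < f t)
  (hfdecr : forall s t : R, 0 < s -> s < t -> f t < f s)
  (phi : R -> R) (gam : R)
  (hgam : 0 < gam < 1)
  (hphiholder : locally_holder_pos gam phi)
  (hphipos : forall t : R, 0 < t -> 0 < phi t)
  (hphinoninc : forall s t : R, 0 < s -> s <= t -> phi t <= phi s) :
  (exists u : 'rV[R]_N -> R,
     [/\ C2_on (~` K) u,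
         forall x : 'rV[R]_N, ~ K x -> 0 < u x &
         forall x : 'rV[R]_N, ~ K x ->
           phi (edist_set x (boundary K)) * f (u x) <= - laplacian u x])
  <->
  (\int[lebesgue_measure]_(r in `]0%R, +oo[) (r * phi r)%:E < +oo)%E.
Proof.
have cK : closed K := compact_closed (@norm_hausdorff _ _) hKcompact.
have [fK comp] := hKcomponents.
have phi_cont := locally_holder_continuous (proj1 (andP hgam)) hphiholder.
have [A dA] := antiderivative_pos phi_cont.
have A_cont (t : R) : 0 < t -> {for t, continuous A}.
  by move=> /dA[dAt _]; exact/differentiable_continuous/derivable1_diffP.
have [P dP] := antiderivative_pos A_cont.
have [p [D [bp ccD CD]]] : exists p D, [/\ boundary K p,
    connected_component K p = closure D & C2_domain D].
  have [x [C [[y Ky <-] [D CD ccD]] _]] := hK1.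
  have DK : D `<=` K.
    by move=> q /(@subset_closure _ D); rewrite -ccD; exact: connected_component_sub.
  have [r _ rP] := compact_in_eball 0 hKcompact.
  have Dr q : D q -> enorm q < r by move=> /DK /rP; rewrite subr0.
  have [D0 oD _ _] := CD.
  have [p Dp] := bounded_open_boundary (Ordinal (leq_trans (isT : (0 < 3)%N) hN)) D0 oD Dr.
  have Cp : connected_component K y p by rewrite ccD; case: Dp.
  have Kp := connected_component_sub Cp.
  have ccp : connected_component K p = closure D.
    by rewrite -ccD; apply/esym; exact: same_connected_component.
  exists p, D; split => //; exact: component_boundary ccp CD Dp.
have bK : boundary K !=set0 by exists p.
have Kp := boundary_sub cK bp.
have h_cont (t : R) : 0 < t -> {for t, continuous (fun s : R => s * phi s)}.
  by move=> t0; apply: continuousM; [exact: cvg_id|exact: phi_cont].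
have h_ge0 (t : R) : 0 < t -> 0 <= t * phi t.
  by move=> t0; rewrite mulr_ge0 ?ltW// hphipos.
rewrite (integral_pos_finiteP h_cont h_ge0 (fun t : R => is_derive_moment dA dP (t := t))).
split.
- move=> [u [Cu upos uineq]].
  have [r r0 Kr] := compact_in_eball p hKcompact.
  have [mu muP] := moment_bounded_above hN cK hfpos hfdecr phi_cont hphipos hphinoninc
    dA dP Cu upos uineq bp r0 Kr.
  have [e [c [c0 [Ce ep flat]]]] := flattens_exists cK fK Kp (proj2 bp) ccD CD.
  have ce : {for p, continuous (fun x => c * e x)}.
    by have [] := @C2_onZ R N setT openT c e Ce p Logic.I.
  have ce1 : c * e p < 1 by rewrite ep mulr0.
  have [r2 r20 flat'] : exists2 r, 0 < r & forall x, enorm (x - p) < r ->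
      [/\ K x <-> e x <= 0, gradsq e x <= c, 1 <= - laplacian e x <= c,
       c * e x <= 1 & ~ K x -> edist_set x (boundary K) <= c * e x].
    apply: nbhs_eball; apply: filterS2 flat (near_le_bound ce ce1).
    move=> x [KE /andP[_ g2] l dist] exc; split => //.
    by move=> /dist[].
  have r30 : 0 < r2 / 2 by rewrite divr_gt0.
  have flat'' x : enorm (x - p) < 2 * (r2 / 2) ->
      [/\ K x <-> e x <= 0, gradsq e x <= c, 1 <= - laplacian e x <= c,
       c * e x <= 1 & ~ K x -> edist_set x (boundary K) <= c * e x].
    by rewrite mulrC divfK//; exact: flat'.
  have [ml mlP] := moment_bounded_below cK hfpos hfdecr phi_cont hphipos hphinoninc
    dA dP Cu upos uineq bp c0 Ce ep r30 flat''.
  exists (mu - ml) => a b a0 ab.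
  by rewrite lerB ?muP ?mlP// (lt_trans a0).
- move=> [M MP].
  have [V [CV V0 VP]] := global_supersolution hN hKcompact hKcomponents bK phi_cont hphipos
    hphinoninc dA dP MP.
  have oK := closed_openC cK.
  have f1 : 0 < f 1 := hfpos _ ltr01.
  have CfV := C2_onZ oK (f 1) CV.
  exists (fun x => 1 + f 1 * V x); split.
  + exact (C2_onD oK (C2_on_cst oK 1) CfV).
  + by move=> x Kx; rewrite ltr_wpDr// mulr_ge0 ?V0// ltW.
  + move=> x Kx; rewrite (laplacianD oK (C2_on_cst oK 1) CfV Kx) laplacian_cst add0r.
    rewrite (laplacianZ oK (f 1) CV Kx) -mulrN mulrC.
    have d0 : 0 < edist_set x (boundary K).
      apply: edist_set_gt0 => //; first exact: closed_boundary.
      by move=> /(boundary_sub cK).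
    have fu : f (1 + f 1 * V x) <= f 1.
      have : 0 <= f 1 * V x by rewrite mulr_ge0 ?V0// ltW.
      rewrite le_eqVlt => /orP[/eqP <-|fV]; first by rewrite addr0.
      by rewrite ltW// hfdecr// ltrDl.
    apply: (@le_trans _ _ (f 1 * phi (edist_set x (boundary K)))).
      by rewrite ler_wpM2r// ltW// hphipos.
    by rewrite ler_wpM2l ?VP// ltW.
Qed.
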